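(* Suppose that $\sup_{t\in[0,T]}\beta^\pm_t\in L^1([0,1]^2)$ and $\int_{[0,1]^2}\sup_{t\in[0,T]}|\beta^{n,\pm}_t(x,y)-\beta^\pm_t(x,y)|\,dx\,dy\to0$ as $n\to\infty$. Then the sequence of path-valued random variables $\{(H^n_t)_{t\in[0,T]}:n\ge1\}$, regarded as random variables in $\mathbb D([0,T]:\mathcal S_0)$ where $\mathcal S_0$ carries the weak topology, does not satisfy a large deviation principle (with any speed) with a non-trivial rate function.
   Context: Fix $T\in(0,\infty)$; write $[0,1]^2_T=[0,1]^2\times[0,T]$ and $[n]=\{1,\dots,n\}$. All $L^p$ spaces are with respect to Lebesgue measure. Let $Q^n_1=[0,1/n]$, $Q^n_i=((i-1)/n,i/n]$ for $2\le i\le n$, and $Q^n_{i,j}=Q^n_i\times Q^n_j$. Rates. $\beta^+,\beta^-:[0,1]^2\times[0,T]\to[0,\infty)$ are measurable, with $\beta^\pm_t(x,y)=\beta^\pm(x,y,t)$. For each $n$ and $i,j\in[n]$, $\beta^{n,\pm}_{i,j}:[0,T]\to[0,\infty)$ are measurable and $\beta^{n,\pm}_t(x,y)=\beta^{n,\pm}(x,y,t)=\sum_{i,j=1}^n\beta^{n,\pm}_{i,j}(t)\mathbf 1_{Q^n_{i,j}}(x,y)$. Standing assumptions: (a) $\beta^{n,\pm},\beta^\pm\in L^1([0,1]^2_T)$ and $\beta^{n,\pm}\to\beta^\pm$ in $L^1([0,1]^2_T)$; (b) there is $c_\beta>0$ with $\beta^{n,\pm}_{i,j}(t)\ge c_\beta$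 for all $n\ge1$, $i,j\in[n]$, $t\in[0,T]$; (c) $t\mapsto\beta^\pm_t(x,y)$ is bounded and left-continuous for a.e. $(x,y)\in[0,1]^2$, and $t\mapsto\beta^{n,\pm}_{i,j}(t)$ is bounded and left-continuous for all $i,j\in[n]$ and all large enough $n$. Graph process. $a(n)\in(0,\infty)$ with $a(n)\to\infty$. For each $n$, $\{X^n_{i,j}(t):t\in[0,T]\}_{i,j\in[n]}$ are $n^2$ mutually independent (càdlàg) Markov chains on $\{0,1\}$, with deterministic initial values $X^n_{i,j}(0)=x^n_{i,j}\in\{0,1\}$, jumping at time $t$ from $0$ to $1$ at rate $a(n)\beta^{n,+}_{i,j}(t)$ and from $1$ to $0$ at rate $a(n)\beta^{n,-}_{i,j}(t)$; all are defined on one probability space $(\Omega,\mathcal F,\mathbb P)$. Put $H^n_t(x,y)=\sum_{i,j=1}^nX^n_{i,j}(t)\mathbf 1_{Q^n_{i,j}}(x,y)$. $\mathcal S_0$ is the set of measurable $f:[0,1]^2\to\mathbb R$ with $0\le f\le1$ a.e. (identified if equal a.e.). The weak topology on $\mathcal S_0$ is inherited from the weak topology of $L^2([0,1]^2)$; it is compact and metrizable, with a metric $d_{\mathcal S_0,\mathrm{weak}}$. $\mathbb D([0,T]:S)$ is the space of càdlàg paths in a metric space $S$ with the Skorokhod topology. LDP. For a metric space $S$, a rate function is $I:S\to[0,\infty]$ with $\{I\le r\}$ compact for every $r<\infty$. $S$-valued random variables $Y_n$ satisfy an LDP with speed $b(n)$ (a sequence of positive reals) and rate function $I$ if $\limsup_n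 b(n)^{-1}\log\mathbb P(Y_n\in F)\le-\inf_FI$ for all closed $F$ and $\liminf_nb(n)^{-1}\log\mathbb P(Y_n\in G)\ge-\inf_GI$ for all open $G$. A rate function is trivial if it only takes values in $\{0,\infty\}$. *)

(* Defs.v *)
From HB Require Import structures.
From mathcomp Require Import all_boot all_order all_algebra.
From mathcomp Require Import all_classical all_reals all_analysis.
From mathcomp Require Import measurable_realfun.

Set Implicit Arguments.
Unset Strict Implicit.
Unset Printing Implicit Defensive.

Import Order.TTheory GRing.Theory Num.Theory.
Import numFieldNormedType.Exports.

Local Open Scope classical_set_scope.
Local Open Scope ring_scope.

Section lebesgue.
Variable R : realType.

Definition plane := (measurableTypeR R * measurableTypeR R)%type.

Definition leb2 : {measure set plane -> \bar R} :=
  (@lebesgue_measure R \x @lebesgue_measure R)%E.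

Definition leb3 : {measure set (plane * measurableTypeR R)%type -> \bar R} :=
  (leb2 \x @lebesgue_measure R)%E.

Definition unit_square : set plane := `[0, 1]%classic `*` `[0, 1]%classic.

Definition cylinder (T : R) : set (plane * measurableTypeR R)%type :=
  unit_square `*` `[0, T]%classic.

Lemma measurable_unit_square : measurable unit_square.
Proof. by apply: measurableX; exact: measurable_itv. Qed.

Definition leb_square : {measure set plane -> \bar R} :=
  mrestr leb2 measurable_unit_square.

(** Membership of an almost-everywhere class in L^1: the function itself, for
    instance a supremum over an uncountable set of times, need not be Borel. *)
Definition in_L1 (D : set plane) (f : plane -> \bar R) :=
  exists g : plane -> \bar R,
    leb2.-integrable D g /\ ae_eq leb2 D f g.

(** [\int[leb2 R]_(z in D) f z] of a nonnegative [f] is the supremum of the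
    integrals of the simple functions below [f]; for the suprema over time it is
    the Lebesgue integral, as these agree a.e. with Borel functions. *)
Definition sup_time (T : R) (f : R -> R) : \bar R :=
  ereal_sup [set (f t)%:E | t in `[0, T]%classic].

Definition bounded_left_continuous (T : R) (f : R -> R) :=
  (exists M : R, forall t, 0 <= t <= T -> `|f t| <= M) /\
  (forall t, 0 < t <= T -> f s @[s --> t^'-] --> f t).

End lebesgue.

Section step.
Variable R : realType.

(** The index is 0-based: for i : 'I_n, [Q i] is the (i+1)-st interval of the partition. *)
Definition Q (n : nat) (i : 'I_n) : set R :=
  [set x | (if val i == 0%N then 0 <= x else i%:R / n%:R < x) /\
           x <= i.+1%:R / n%:R].

Definition step (n : nat) (c : 'I_n -> 'I_n -> R) (z : plane R) : R :=
  \sum_(i < n) \sum_(j < n) c i j * \1_(Q i `*` Q j) z.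

Lemma measurable_Q n (i : 'I_n) : measurable (Q i : set (measurableTypeR R)).
Proof.
have -> : Q i = if val i == 0%N then `[0, i.+1%:R / n%:R]%classic
                else `]i%:R / n%:R, i.+1%:R / n%:R]%classic.
  apply/seteqP; split=> x; rewrite /Q /=; case: ifP => _ /=;
    by rewrite in_itv /=; move=> ?; apply/andP.
by case: ifP => _; exact: measurable_itv.
Qed.

Lemma measurable_step n (c : 'I_n -> 'I_n -> R) :
  measurable_fun [set: plane R] (step c : plane R -> measurableTypeR R).
Proof.
apply: measurable_sum => i. apply: measurable_sum => j.
apply: measurable_funM; first exact: measurable_cst.
by apply: measurable_indic; apply: measurableX; exact: measurable_Q.
Qed.

Lemma Q_inj n (i j : 'I_n) (x : R) : Q i x -> Q j x -> i = j.
Proof.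
wlog ij : i j / (i < j)%N.
  move=> h; case: (ltngtP i j) => [||/val_inj //]; first exact: h.
  by move=> ji qi qj; apply/esym/(h j i).
rewrite /Q /= => -[_ xi] [+ _].
have -> : (val j == 0%N) = false by apply/negbTE; rewrite -lt0n (leq_ltn_trans _ ij).
rewrite ltNge => /negP []; apply: (le_trans xi).
by rewrite ler_wpM2r ?invr_ge0// ler_nat.
Qed.

Lemma step_bool_range n (c : 'I_n -> 'I_n -> bool) (z : plane R) :
  0 <= step (fun i j => (c i j)%:R) z <= 1.
Proof.
pose q (k : 'I_n * 'I_n) := Q k.1 z.1 /\ Q k.2 z.2.
rewrite /step pair_big /=.
have [[k0 k0z]|nk] := pselect (exists k, q k); last first.
  rewrite big1 ?lexx ?ler01// => k _.
  rewrite indicE memNset ?mulr0// => -[] k1 k2.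
  by apply: nk; exists k.
rewrite (bigD1 k0)//= big1 ?addr0; last first.
  move=> k /eqP kk0; rewrite indicE memNset ?mulr0// => -[k1 k2].
  apply: kk0; case: k k1 k2 k0z => a b /= k1 k2 []; case: k0 => a0 b0 /= l1 l2.
  by rewrite (Q_inj k1 l1) (Q_inj k2 l2).
by rewrite indicE; case: (c _ _); case: (_ \in _);
  rewrite ?mulr0 ?mulr1 ?mul0r ?mul1r ?lexx ?ler01.
Qed.

End step.

Section S0.
Variable R : realType.

Local Notation aeq := {mfun_ leb_square R, plane R >-> measurableTypeR R}.

(** Classes of functions on the whole plane: [leb_square R] ignores the values
    outside the unit square. *)
Definition S0 : Type :=
  {f : aeq | `[< {ae leb_square R, forall z, 0 <= f z <= 1} >]}.

HB.instance Definition _ := Choice.on S0.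

Definition pairing (f : S0) : {ptws LfunType (leb_square R) (lee1n 2) -> R} :=
  fun g => \int[leb_square R]_z (sval f z * g z).

(** The weak topology of L^2 is that of the pairings with the g in L^2; below,
    any metric on S_0 that induces it is allowed. *)
Definition S0_weak : topologicalType := initial_topology pairing.

Record weak_metric := WeakMetric {
  wdist : S0 -> S0 -> R ;
  wdistxx : forall f, wdist f f = 0 ;
  wdist_eq0 : forall f g, wdist f g = 0 -> f = g ;
  wdist_sym : forall f g, wdist f g = wdist g f ;
  wdist_triangle : forall g f h, wdist f h <= wdist f g + wdist g h ;
  wdist_weak : forall (f : S0) (A : set S0),
    nbhs (f : S0_weak) A <->
    exists2 e : R, 0 < e & [set g | wdist f g < e] `<=` A }.

Definition S0_metric (m : weak_metric) : Type := S0.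

HB.instance Definition _ m := Choice.on (S0_metric m).
HB.instance Definition _ m := @isMetric.Build R (S0_metric m) (wdist m)
  (wdistxx m) (@wdist_eq0 m) (wdist_sym m) (wdist_triangle m).

HB.instance Definition _ n (c : 'I_n -> 'I_n -> R) :=
  isMeasurableFun.Build _ _ _ _ (step c : plane R -> measurableTypeR R)
    (measurable_step c).

Section graphon.
Variables (n : nat) (c : 'I_n -> 'I_n -> bool).

Let g : aeq :=
  (\pi_aeq (step (fun i j => (c i j)%:R) : {mfun plane R >-> measurableTypeR R}))%qT.

Lemma graphon_subproof : `[< {ae leb_square R, forall z, 0 <= g z <= 1} >].
Proof.
have gE : ae_eq (leb_square R) setT g (step (fun i j => (c i j)%:R)).
  have /eqP : (\pi_aeq (repr g) = g)%qT by exact: reprK.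
  by rewrite eqmodE => /asboolP.
by apply/asboolP; apply: filterS gE => z /(_ I) ->; exact: step_bool_range.
Qed.

Definition graphon : S0 := exist _ g graphon_subproof.

End graphon.

End S0.

Section cadlag.
Variables (R : realType) (T : R).

Definition time : Type := set_type `[0, T]%classic.

HB.instance Definition _ := Topological.copy time (set_type `[0, T]%classic).

Definition time_val (t : time) : R := \val t.

(** At the end points one of the two filters below is improper and the
    corresponding condition is void. *)
Definition cadlag (S : topologicalType) (phi : time -> S) :=
  forall t : time,
    phi s @[s --> within [set s : time | time_val t < time_val s] (nbhs t)] --> phi t /\
    exists l : S,
      phi s @[s --> within [set s : time | time_val s < time_val t] (nbhs t)] --> l.

Record cadlag_path (S : topologicalType) := CadlagPath {
  path_fun :> time -> S ;
  path_cadlag : cadlag path_fun }.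

HB.instance Definition _ (S : topologicalType) := gen_eqMixin (cadlag_path S).
HB.instance Definition _ (S : topologicalType) := gen_choiceMixin (cadlag_path S).

Definition time_change (lam : time -> time) :=
  bijective lam /\ forall s t : time, time_val s < time_val t -> time_val (lam s) < time_val (lam t).

(** [skorokhod_ball phi e psi] says that
    inf_lam max (sup_t |lam t - t|, sup_t d(phi t, psi (lam t))) < e,
    the infimum being over all time changes. *)
Definition skorokhod_ball (S : metricType R) (phi : cadlag_path S) (e : R)
    (psi : cadlag_path S) : Prop :=
  exists2 lam, time_change lam & exists2 r, r < e &
    forall t : time, `|time_val (lam t) - time_val t| <= r /\ mdist (phi t) (psi (lam t)) <= r.

Lemma time_val_inj : injective time_val.
Proof. exact: val_inj. Qed.

Section skorokhod.
Variable S : metricType R.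
Implicit Types phi psi : cadlag_path S.

Local Notation ent := (entourage_ (@skorokhod_ball S)).

Let center phi e : 0 < e -> skorokhod_ball phi e phi.
Proof.
move=> e0; exists id; first by split => //; exists id.
by exists 0 => // t; rewrite subrr normr0 mdistxx.
Qed.

Let ball_sym phi psi e : skorokhod_ball phi e psi -> skorokhod_ball psi e phi.
Proof.
move=> [lam [[mu lamK muK] lamI] [r re h]]; exists mu.
  split; first by exists lam.
  move=> s t st; rewrite ltNge le_eqVlt; apply/negP => /orP[/eqP|].
    by move=> /time_val_inj /(congr1 lam); rewrite !muK => ts; rewrite ts ltxx in st.
  by move=> /lamI; rewrite !muK ltNge ltW.
exists r => // t; have := h (mu t); rewrite muK distrC => -[? ?].
by rewrite metric_sym.
Qed.

Let triangle phi psi xi e1 e2 : skorokhod_ball phi e1 psi ->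
  skorokhod_ball psi e2 xi -> skorokhod_ball phi (e1 + e2) xi.
Proof.
move=> [lam [lamB lamI] [r re h]] [mu [muB muI] [r' re' h']]; exists (mu \o lam).
  by split; [exact: bij_comp|move=> s t /lamI /muI].
exists (r + r') => [|t /=]; first exact: ltrD.
have [h1 h2] := h t; have [h3 h4] := h' (lam t); split.
  by apply: (le_trans (ler_distD (time_val (lam t)) _ _)); rewrite addrC lerD.
by apply: (le_trans (metric_triangle _ (psi (lam t)) _)); rewrite lerD.
Qed.

HB.instance Definition _ := hasNbhs.Build (cadlag_path S) (nbhs_ ent).

HB.instance Definition _ := @Nbhs_isPseudoMetric.Build R (cadlag_path S)
  ent erefl (@skorokhod_ball S) center ball_sym triangle erefl.

End skorokhod.

Lemma cadlag_comp (S : topologicalType) (I : finType)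
    (X : I -> cadlag_path bool) (F : (I -> bool) -> S) :
  cadlag (fun t => F (fun i => X i t)).
Proof.
have near_const (G : set_system time) (l : I -> bool) : Filter G ->
    (forall i, X i s @[s --> G] --> l i) ->
    F (fun i => X i s) @[s --> G] --> F l.
  move=> FG Xl; apply: cvg_near_cst.
  have : \forall s \near G, forall i, X i s = l i.
    apply: filter_forall => i; apply: (Xl i [set b | b = l i]).
    exact/principal_filterP.
  by apply: filterS => s sl; congr F; apply/funext.
move=> t; split.
  by apply: near_const => i; case: (path_cadlag (X i) t).
have /choice[l Xl] : forall i, exists l : bool,
    X i s @[s --> within [set s : time | time_val s < time_val t] (nbhs t)] --> l.
  by move=> i; case: (path_cadlag (X i) t).
by exists (F l); exact: near_const.
Qed.

End cadlag.

Section ldp.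
Variable R : realType.
Local Open Scope ereal_scope.

Definition rate_function (S : topologicalType) (I : S -> \bar R) :=
  (forall x, 0 <= I x) /\ forall r : R, compact [set x | I x <= r%:E].

Definition trivial_rate_function (S : Type) (I : S -> \bar R) :=
  forall x, I x = 0 \/ I x = +oo.

Definition satisfies_LDP d (Omega : measurableType d) (P : probability Omega R)
    (S : topologicalType) (Y : nat -> Omega -> S) (b : nat -> R)
    (I : S -> \bar R) :=
  (forall F : set S, closed F ->
    limn_esup (fun n => (b n)^-1%:E * lne (P [set w | F (Y n w)]))
      <= - ereal_inf [set I x | x in F]) /\
  (forall G : set S, open G ->
    - ereal_inf [set I x | x in G]
      <= limn_einf (fun n => (b n)^-1%:E * lne (P [set w | G (Y n w)]))).

End ldp.

Section chains.
Context d (Omega : measurableType d) (R : realType) (P : probability Omega R).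
Variable T : R.

Definition process_events (X : Omega -> cadlag_path T bool) : set (set Omega) :=
  <<s [set E | exists t x, E = [set w | X w t = x]] >>.

Definition past_events (X : Omega -> cadlag_path T bool) (s : time T) :
    set (set Omega) :=
  <<s [set E | exists t x, time_val t <= time_val s /\ E = [set w | X w t = x]] >>.

Definition mutually_independent (I : finType)
    (X : I -> Omega -> cadlag_path T bool) :=
  forall (J : {set I}) (A : I -> set Omega),
    (forall i, i \in J -> process_events (X i) (A i)) ->
    P (\bigcap_(i in [set i | i \in J]) A i) = (\prod_(i in J) P (A i))%E.

(** The state [true] is 1, and [rate x] is the rate of the jumps that lead to
    the state [x] from the other state.  [p s t x y] is the probability of
    being in [y] at time [t] given [x] at time [s]; the rates being only
    measurable, the Kolmogorov forward equation is stated in integrated form. *)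
Definition transition_function (rate : bool -> R -> R)
    (p : R -> R -> bool -> bool -> R) :=
  forall s t x y, 0 <= s -> s <= t -> t <= T ->
  [/\ 0 <= p s t x y, p s t x true + p s t x false = 1,
      measurable_fun `[s, T]%classic (fun r => p s r x y) &
      p s t x y = (x == y)%:R +
        \int[@lebesgue_measure R]_(r in `[s, t])
          (p s r x (~~ y) * rate y r - p s r x y * rate (~~ y) r)].

Definition markov_chain (rate : bool -> R -> R) (x0 : bool)
    (X : Omega -> cadlag_path T bool) :=
  [/\ forall t, measurable_fun setT (fun w => X w t),
      forall w (t : time T), time_val t = 0 -> X w t = x0 &
      exists2 p, transition_function rate p &
        forall (s t : time T) (A : set Omega) x y,
          time_val s <= time_val t -> past_events X s A ->
          P (A `&` [set w | X w s = x] `&` [set w | X w t = y]) =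
          ((p (time_val s) (time_val t) x y)%:E * P (A `&` [set w | X w s = x]))%E].

End chains.

Definition graphon_path (R : realType) (T : R) (m : weak_metric R) (n : nat)
    (X : 'I_n -> 'I_n -> cadlag_path T bool) : cadlag_path T (S0_metric m) :=
  CadlagPath (@cadlag_comp R T (S0_metric m) ('I_n * 'I_n)%type
    (fun k => X k.1 k.2) (fun c => graphon R (fun i j => c (i, j)))).

(* Main.v *)
Require Import Defs.
From HB Require Import structures.
From mathcomp Require Import all_boot all_order all_algebra.
From mathcomp Require Import all_classical all_reals all_analysis.
From mathcomp Require Import measurable_realfun lra ring.

Set Implicit Arguments.
Unset Strict Implicit.
Unset Printing Implicit Defensive.

Import Order.TTheory GRing.Theory Num.Theory.
Import numFieldNormedType.Exports.

Local Open Scope classical_set_scope.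
Local Open Scope ring_scope.

(** Suppose an LDP with speed [b] and rate function [I] holds.
    - Single flips move [H^n] by [O (1 / n ^ 2)] in any weak functional and two
      chains never flip together, so [I phi] is finite only for continuous [phi].
    - The infimum of [I] is [0]; were [I] nontrivial, there would be two distinct
      continuous paths [phi1], [phi2] of finite cost, say [phi1 t0 <> phi2 t0].
    - The chains forget their state after a time of order [1 / a n].  On a grid of
      [2 k] times near [t0], the law of large numbers applied afresh at each time
      makes one of the two paths cost at least [k c n ^ 2], for every [k]; hence
      [b n / n ^ 2] tends to infinity.
    - Going from the full to the empty graph during [[T / 2, T / 2 + th]] costs at
      most [C n ^ 2], with [C] independent of [th]: this is where the bounds on
      the suprema of the rates enter.  At speed [b n >> n ^ 2] this is free, and
      compactness of [{I <= 1}] yields, as [th] tends to [0], a path of finite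
      cost that jumps at time [T / 2], a contradiction. *)

(** * Primitives and barriers *)

(** Neither the speed nor the zeros of the rate function are known, and no limit of [H^n] is ever
    identified. Two distinct paths make up for this: wherever the typical value of a functional
    separating them lies, it is on the wrong side of the midpoint for one of them. Since the
    forgetting time of order [1 / a n] falls below any fixed grid spacing, every grid time brings
    its own cost of order [n ^ 2], and the number of times is free. In the passage from the full to
    the empty graph [a n] cancels: a window of any fixed positive length is eventually long on the
    scale [1 / a n], and each edge then pays an amount governed by the ratio of its largest to its
    smallest rate. That price is bounded linearly in the upper bound of the rate, so an averaged
    bound over the edges suffices. The form of the events has another cause: only the values of the
    chains at fixed times are given as measurable. The open and closed sets of paths are therefore
    built from tubes, whose preimages reduce to countably many times, and from conditions at the
    single time [T]. *)

Section slope.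
Variable R : realType.
Implicit Types (u g : R -> R) (s t c q M : R).

(* [g] is a derivative of [u] known only through integrals: the rates are merely
   measurable. *)
Definition has_slope s (T : R) u g := forall t1 t2 c, s <= t1 -> t1 <= t2 -> t2 <= T ->
  ((forall r, t1 <= r <= t2 -> c <= g r) -> c * (t2 - t1) <= u t2 - u t1) /\
  ((forall r, t1 <= r <= t2 -> g r <= c) -> u t2 - u t1 <= c * (t2 - t1)).

Lemma primitive_slope s (T : R) u g (u0 : R) :
  (@lebesgue_measure R).-integrable `[s, T]%classic (EFin \o g) ->
  (forall t, s <= t <= T ->
     u t = u0 + \int[@lebesgue_measure R]_(r in `[s, t]) g r) ->
  has_slope s T u g.
Proof.
move=> gi uE t1 t2 c st1 t12 t2T.
have incr : u t2 - u t1 = \int[@lebesgue_measure R]_(r in `[t1, t2]) g r.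
  rewrite !uE ?st1 ?t2T ?(le_trans st1) ?(le_trans t12)//.
  rewrite [_ + _ - _](_ : _ = \int[@lebesgue_measure R]_(r in `[s, t2]) g r -
    \int[@lebesgue_measure R]_(r in `[s, t1]) g r); last by ring.
  have i2 : (@lebesgue_measure R).-integrable `[s, t2]%classic (EFin \o g).
    by apply: integrableS gi => //; apply: subset_itvl; rewrite bnd_simp.
  rewrite Rintegral_itvB ?bnd_simp// Rintegral_itv_obnd_cbnd//.
  by apply: integrableS i2 => //; apply: subset_itvr; rewrite bnd_simp.
have mI : measurable (`[t1, t2]%classic : set (measurableTypeR R)) by [].
have i12 : (@lebesgue_measure R).-integrable `[t1, t2]%classic (EFin \o g).
  apply: integrableS gi => // r /=; rewrite !in_itv/= => /andP[a b].
  by rewrite (le_trans st1)// (le_trans b).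
have ci : (@lebesgue_measure R).-integrable `[t1, t2]%classic
    (EFin \o (fun _ : R => c)).
  apply: measurable_bounded_integrable => //.
    by rewrite /= lebesgue_measure_itv/=; case: ifP => _; rewrite ?ltry// -EFinB ltry.
  exact: bounded_cst.
have cE : \int[@lebesgue_measure R]_(r in `[t1, t2]) c = c * (t2 - t1).
  rewrite Rintegral_cst//= lebesgue_measure_itv/= lte_fin.
  move: t12; rewrite le_eqVlt => /orP[/eqP->|->//]; by rewrite ltxx subrr.
split=> h; rewrite incr -cE; apply: le_Rintegral => // r /=;
  by rewrite in_itv/= => /h.
Qed.

Lemma slope_cst s T u g c t1 t2 : has_slope s T u g ->
  s <= t1 -> t1 <= t2 -> t2 <= T ->
  (forall r, t1 <= r <= t2 -> c <= g r) -> c * (t2 - t1) <= u t2 - u t1.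
Proof. by move=> h a b d e; have [+ _] := h t1 t2 c a b d; exact. Qed.

Lemma slope_Lipschitz s T u g M t1 t2 : has_slope s T u g ->
  (forall r, s <= r <= T -> `|g r| <= M) ->
  s <= t1 -> t1 <= t2 -> t2 <= T -> `|u t2 - u t1| <= M * (t2 - t1).
Proof.
move=> h gM st1 t12 t2T; rewrite ler_norml -mulNr.
have gM' r : t1 <= r <= t2 -> - M <= g r <= M.
  by move=> /andP[a b]; rewrite -ler_norml gM// (le_trans st1)//= (le_trans b).
have [_ ub] := h t1 t2 M st1 t12 t2T; have [lb _] := h t1 t2 (- M) st1 t12 t2T.
by rewrite lb ?ub// => r /gM' /andP[].
Qed.

(** Let [v] be the last time, as a supremum, at which [q <= u]. The Lipschitz bound carries [q <= u]
    over to [v] itself, and after [v] the function is below [q], hence cannot decrease any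
    further. *)
Lemma slope_barrier s T u g M q t1 t2 : has_slope s T u g ->
  (forall r, s <= r <= T -> `|g r| <= M) ->
  (forall r, s <= r <= T -> u r < q -> 0 <= g r) ->
  s <= t1 -> t1 <= t2 -> t2 <= T -> q <= u t1 -> q <= u t2.
Proof.
move=> h gM g0 st1 t12 t2T qt1; rewrite leNgt; apply/negP => ut2.
have M0 : 0 <= M by apply: le_trans (gM t1 _); rewrite ?st1 ?(le_trans t12).
(* [M] may vanish, hence the division by [M + 1]. *)
have Me e : 0 < e -> M * (e / (M + 1)) <= e.
  by move=> e0; rewrite mulrA ler_pdivrMr ?ltr_wpDl// mulrDr mulr1 mulrC lerDl ltW.
pose E := [set t | t1 <= t <= t2 /\ q <= u t].
have Et1 : E t1 by split => //; rewrite lexx.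
have supE : has_sup E.
  by split; [exists t1|exists t2 => x [/andP[]]].
pose v := sup E.
have t1v : t1 <= v by apply: ub_le_sup => //; case: supE.
have vt2 : v <= t2 by apply: ge_sup; [exists t1|move=> x [/andP[]]].
have lip := slope_Lipschitz h gM.
have quv : q <= u v.
  apply/ler_addgt0Pr => e e0.
  have e' : 0 < e / (M + 1) by rewrite divr_gt0// ltr_wpDl.
  have [x Ex xv] := sup_adherent e' supE.
  have xv' : x <= v by apply: ub_le_sup => //; case: supE.
  case: Ex => /andP[t1x xt2] qux.
  have := lip _ _ (le_trans st1 t1x) xv' (le_trans vt2 t2T).
  rewrite ler_distl => /andP[+ _]; apply: contra_leT; rewrite -!ltNge => uvq.
  have : M * (v - x) <= e.
    apply: (@le_trans _ _ (M * (e / (M + 1)))).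
      by rewrite ler_wpM2l// lerBlDr addrC -lerBlDr ltW.
    exact: Me.
  by move=> ?; lra.
have uvt2 : u v <= u t2.
  apply/ler_addgt0Pr => e e0.
  have vt2' : v < t2.
    by rewrite lt_neqAle vt2 andbT; apply/eqP => vE; move: quv; rewrite vE leNgt ut2.
  (* The slope is known to be nonnegative only strictly after [v]: the comparison starts at
     [v + dl], at a loss of at most [M * dl <= e]. *)
  pose dl := Num.min (e / (M + 1)) (t2 - v).
  have dl0 : 0 < dl by rewrite lt_min subr_gt0 vt2' andbT divr_gt0 ?ltr_wpDl.
  have dle : M * dl <= e.
    apply: (@le_trans _ _ (M * (e / (M + 1)))).
      by rewrite ler_wpM2l// ge_min lexx.
    exact: Me.
  have vdl : v + dl <= t2 by rewrite addrC -lerBrDr ge_min lexx orbT.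
  have sv : s <= v by exact: le_trans t1v.
  have := lip v (v + dl) sv _ (le_trans vdl t2T).
  rewrite lerDl ltW// => /(_ isT); rewrite (addrC v) addrK ler_distl => /andP[+ _].
  have k r : v + dl <= r <= t2 -> 0 <= g r.
    move=> /andP[vr rt2]; have vr' : v < r by rewrite (lt_le_trans _ vr)// ltrDl.
    apply: g0; rewrite ?(le_trans rt2)// ?andbT; first by rewrite (le_trans sv)// ltW.
    rewrite ltNge; apply/negP => qr; have : r <= v.
      by apply: ub_le_sup; [case: supE|split => //; rewrite rt2 (le_trans t1v)// ltW].
    by rewrite leNgt vr'.
  have svd : s <= v + dl by rewrite (le_trans sv)// lerDl ltW.
  by rewrite (addrC dl); have := slope_cst h svd vdl t2T k; rewrite mul0r; lra.
by move: (lt_le_trans ut2 (le_trans quv uvt2)); rewrite ltxx.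
Qed.

End slope.

(** * Two-state transition functions *)

Section transition.
Context (R : realType) (T Lam B : R) (rate : bool -> R -> R)
  (p : R -> R -> bool -> bool -> R).
Hypothesis Lam_gt0 : 0 < Lam.
Hypothesis rate_meas : forall y, measurable_fun `[0, T]%classic (rate y).
Hypothesis rate_ge : forall y t, 0 <= t <= T -> Lam <= rate y t.
Hypothesis rate_le : forall y t, 0 <= t <= T -> rate y t <= B.
Hypothesis p_tf : transition_function T rate p.

Let drift s x y r := p s r x (~~ y) * rate y r - p s r x y * rate (~~ y) r.

Lemma transition_sum s t x y : 0 <= s -> s <= t -> t <= T ->
  p s t x y + p s t x (~~ y) = 1.
Proof.
move=> s0 st tT; have [_ h _ _] := p_tf x y s0 st tT.
by case: y => //=; rewrite addrC.
Qed.

Lemma transition_bounds s t x y : 0 <= s -> s <= t -> t <= T ->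
  0 <= p s t x y <= 1.
Proof.
move=> s0 st tT; have [h _ _ _] := p_tf x y s0 st tT; rewrite h /=.
rewrite -(transition_sum x y s0 st tT) lerDl.
by have [] := p_tf x (~~ y) s0 st tT.
Qed.

Lemma drift_bound s x y r : 0 <= s -> s <= r <= T -> `|drift s x y r| <= B.
Proof.
move=> s0 /andP[sr rT].
have r0T : 0 <= r <= T by rewrite rT (le_trans s0 sr).
have prod z v : 0 <= p s r x z * rate v r <= B.
  have /andP[p0 p1] := transition_bounds x z s0 sr rT.
  have l0 : 0 <= rate v r by rewrite (le_trans _ (rate_ge v r0T))// ltW.
  by rewrite mulr_ge0//= -[leRHS]mul1r ler_pM// rate_le.
have := prod y (~~ y); have := prod (~~ y) y.
rewrite /drift ler_norml => /andP[? ?] /andP[? ?]; apply/andP; split; lra.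
Qed.

Lemma drift_integrable s x y : 0 <= s -> s <= T ->
  (@lebesgue_measure R).-integrable `[s, T]%classic (EFin \o drift s x y).
Proof.
move=> s0 sT; apply: measurable_bounded_integrable => //.
- by rewrite /= lebesgue_measure_itv/=; case: ifP => _; rewrite ?ltry// -EFinB ltry.
- have mr z : measurable_fun `[s, T]%classic (rate z).
    apply: measurable_funS (rate_meas z) => // r /=.
    by rewrite !in_itv/= => /andP[sr ->]; rewrite (le_trans s0 sr).
  have mp z : measurable_fun `[s, T]%classic (fun r => p s r x z).
    by have [] := p_tf x z s0 sT (lexx T).
  by rewrite /drift; apply: measurable_funB; apply: measurable_funM;
    first [exact: mp | exact: mr].
- exists B; split; rewrite ?num_real// => M BM r /=; rewrite in_itv/= => rI.
  by rewrite (le_trans (drift_bound _ _ s0 rI))// ltW.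
Qed.

Lemma transition_slope s x y : 0 <= s -> s <= T ->
  has_slope s T (fun t => p s t x y) (drift s x y).
Proof.
move=> s0 sT; apply: (primitive_slope (drift_integrable x y s0 sT)
  (u0 := (x == y)%:R)) => t /andP[st tT].
by have [] := p_tf x y s0 st tT.
Qed.

Lemma transition_start s x y : 0 <= s -> s <= T -> p s s x y = (x == y)%:R.
Proof.
move=> s0 sT; have [_ _ _ ->] := p_tf x y s0 (lexx s) sT.
by rewrite set_itv1 Rintegral_set1 addr0.
Qed.

Lemma transition_change s t x : 0 <= s -> s <= t -> t <= T ->
  p s t x (~~ x) <= B * (t - s).
Proof.
move=> s0 st tT; have sT := le_trans st tT.
have := slope_Lipschitz (transition_slope x (~~ x) s0 sT)
  (fun r => @drift_bound s x (~~ x) r s0) (lexx s) st tT.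
rewrite transition_start// eq_sym (_ : (~~ x == x) = false) ?subr0; last by case: x.
by apply: le_trans; exact: ler_norm.
Qed.

(** The level [q] solves [Lam - q * (Lam + B) = Lam / 2]. Below it the drift is at least [Lam / 2],
    so it is reached within time [2 / Lam], and it then acts as a barrier. The bound depends on the
    rates only through [B / Lam]. *)
Lemma transition_lower s t x y : 0 <= s -> s <= t -> t <= T ->
  1 <= Lam / 2 * (t - s) -> Lam / (2 * (Lam + B)) <= p s t x y.
Proof.
move=> s0 st tT long; have sT := le_trans st tT.
set q := _ / _.
have B0 : Lam <= B.
  have s0T : 0 <= s <= T by rewrite s0.
  exact: le_trans (rate_ge y s0T) (rate_le y s0T).
have S0 : 0 < Lam + B by move: Lam_gt0 B0; lra.
have q1 : q < 1.
  rewrite /q ltr_pdivrMr ?mulr_gt0// mul1r. by move: Lam_gt0 B0; lra.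
have qE : q * (Lam + B) = Lam / 2 by rewrite /q; field; move: Lam_gt0 B0; lra.
have driftq r : s <= r <= T -> p s r x y < q -> Lam / 2 <= drift s x y r.
  move=> /andP[sr rT] pq; have r0T : 0 <= r <= T by rewrite rT (le_trans s0 sr).
  rewrite /drift; have := transition_sum x y s0 sr rT.
  have /andP[] := transition_bounds x y s0 sr rT.
  have /andP[] := transition_bounds x (~~ y) s0 sr rT.
  have := rate_le (~~ y) r0T; have := rate_ge y r0T.
  move=> ly ub a1 a2 a3 a4 e.
  have : Lam * p s r x (~~ y) <= p s r x (~~ y) * rate y r.
    by rewrite mulrC ler_wpM2l.
  have : p s r x y * rate (~~ y) r <= p s r x y * B by rewrite ler_wpM2l.
  have : p s r x y * (Lam + B) <= q * (Lam + B) by rewrite ler_wpM2r// ltW.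
  have -> : p s r x (~~ y) = 1 - p s r x y by lra.
  by nra.
have [[t1 /andP[st1 t1t] qt1]|none] :=
    pselect (exists2 t1, s <= t1 <= t & q <= p s t1 x y).
  apply: (slope_barrier (transition_slope x y s0 sT)
    (fun r => @drift_bound s x y r s0) _ st1 t1t tT qt1).
  by move=> r rI /(driftq r rI); apply: le_trans; rewrite divr_ge0// ltW.
(* If [q] were never reached, the probability would grow by at least [1] and end above [q < 1]. *)
exfalso; have low r : s <= r <= t -> Lam / 2 <= drift s x y r.
  move=> /andP[sr rt]; apply: driftq; first by rewrite sr (le_trans rt).
  by rewrite ltNge; apply/negP => ?; apply: none; exists r; rewrite ?sr.
have := slope_cst (transition_slope x y s0 sT) (lexx s) st tT low.
have pt : p s t x y < q.
  by rewrite ltNge; apply/negP => ?; apply: none; exists t; rewrite ?st ?lexx.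
have /andP[ps _] := transition_bounds x y s0 (lexx s) sT.
by move=> ?; lra.
Qed.

(* The difference of the two transition probabilities solves
   [D' = - (rate true + rate false) D], [D s = 1]: it stays nonnegative and so
   decreases, which already gives a bound of order [1 / (Lam (t - s))]. *)
Lemma transition_forget s t x : 0 <= s -> s < t -> t <= T ->
  `|p s t x true - p s t false true| <= (2 * Lam * (t - s))^-1.
Proof.
move=> s0 st tT; have st' := ltW st; have sT := le_trans st' tT.
pose D r := p s r true true - p s r false true.
pose lam r := rate true r + rate false r.
have sl : has_slope s T D (fun r => - (D r * lam r)).
  have i1 := drift_integrable true true s0 sT.
  have i2 := drift_integrable false true s0 sT.
  have gE r : s <= r <= T ->
      drift s true true r - drift s false true r = - (D r * lam r).
    move=> /andP[sr rT]; rewrite /drift /D /lam /=.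
    have /= := transition_sum true true s0 sr rT.
    have /= := transition_sum false true s0 sr rT.
    move=> /(congr1 (fun v => v - p s r false true)); rewrite (addrC (p _ _ _ true)) addrK => ->.
    move=> /(congr1 (fun v => v - p s r true true)); rewrite (addrC (p _ _ _ true)) addrK => ->.
    by ring.
  have sl' : has_slope s T D (fun r => drift s true true r - drift s false true r).
    have mI t' : measurable (`[s, t']%classic : set (measurableTypeR R)) by [].
    apply: (@primitive_slope _ _ _ _ _ 1).
      exact: (integrableB (mI T) i1 i2).
    move=> t' /andP[st1 t1T]; rewrite RintegralB//; first last.
    - by apply: integrableS i2 => //; apply: subset_itvl; rewrite bnd_simp.
    - by apply: integrableS i1 => //; apply: subset_itvl; rewrite bnd_simp.
    rewrite /D; have [_ _ _ ->] := p_tf true true s0 st1 t1T.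
    have [_ _ _ ->] := p_tf false true s0 st1 t1T.
    by rewrite /= /drift; ring.
  move=> t1 t2 c a1 a2 a3; have [l1 l2] := sl' t1 t2 c a1 a2 a3.
  have k r : t1 <= r <= t2 -> drift s true true r - drift s false true r = - (D r * lam r).
    by move=> /andP[? ?]; apply: gE; rewrite (le_trans a1)//= (le_trans _ a3).
  by split=> h; [apply: l1|apply: l2] => r rI; rewrite k// h.
have lam_ge r : s <= r <= T -> 2 * Lam <= lam r.
  move=> /andP[sr rT]; have r0T : 0 <= r <= T by rewrite rT (le_trans s0 sr).
  by rewrite mulr_natl mulr2n lerD// rate_ge.
have lam_le r : s <= r <= T -> lam r <= 2 * B.
  move=> /andP[sr rT]; have r0T : 0 <= r <= T by rewrite rT (le_trans s0 sr).
  by rewrite [leRHS]mulr_natl mulr2n lerD// rate_le.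
have Ds : D s = 1 by rewrite /D !transition_start//= subr0.
have D0 r : s <= r -> r <= T -> 0 <= D r.
  move=> sr rT; apply: (slope_barrier (M := 2 * B) sl) sr rT _ => //; last by rewrite Ds.
  - move=> r' /andP[sr rT]; have rI : s <= r' <= T by rewrite sr.
    have := lam_ge _ rI; have := lam_le _ rI.
    have /andP[] := transition_bounds true true s0 sr rT.
    have /andP[] := transition_bounds false true s0 sr rT.
    have : `|D r'| <= 1.
      have /andP[? ?] := transition_bounds true true s0 sr rT.
      have /andP[? ?] := transition_bounds false true s0 sr rT.
      by rewrite ler_norml /D; apply/andP; split; (move: Lam_gt0; lra).
    move=> D1 _ _ _ _ l1 l2; rewrite normrN normrM (ger0_norm (x := lam r'));
      last by (move: Lam_gt0; lra).
    by rewrite -[leRHS]mul1r ler_pM//; (move: Lam_gt0; lra).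
  - move=> r' rI Dr; have := lam_ge _ rI => ?.
    by rewrite oppr_ge0 mulr_le0_ge0// ?ltW//; (move: Lam_gt0; lra).
have D0t := D0 _ st' tT.
(* As [D] decreases, its slope on [[s, t]] is at most [- 2 * Lam * D t]; starting from [1] this
   gives [D t <= 1 - 2 * Lam * (t - s) * D t]. *)
have Dt : D t <= (2 * Lam * (t - s))^-1.
  have gle r : s <= r <= t -> - (D r * lam r) <= - (2 * Lam * D t).
    move=> /andP[sr rt]; have rT := le_trans rt tT.
    rewrite lerN2 (mulrC _ (D t)) ler_pM//; first by (move: Lam_gt0; lra).
      have [_ h] := sl r t 0 sr rt tT; rewrite -subr_le0.
      rewrite -[leRHS](mul0r (t - r)); apply: h => r' /andP[rr' r't].
      have sr' := le_trans sr rr'; have r'T := le_trans r't tT.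
      have := lam_ge r'; rewrite sr' r'T => /(_ isT) ?.
      by rewrite oppr_le0 mulr_ge0 ?D0//; (move: Lam_gt0; lra).
    by apply: lam_ge; rewrite sr.
  have [_ /(_ gle)] := sl s t (- (2 * Lam * D t)) (lexx s) st' tT; rewrite Ds => h.
  rewrite -[leRHS]mul1r ler_pdivlMr ?mulr_gt0 ?subr_gt0//.
  by rewrite mulrA; move: h; rewrite mulNr; have := D0t; nra.
case: x; first by rewrite ger0_norm.
by rewrite subrr normr0 (le_trans D0t Dt).
Qed.

End transition.

(** * An exponential inequality *)

Section chernoff.
Variable R : realType.

(** From [1 - y <= expR (- y)] one gets [expR y <= (1 - y)^-1], and the quadratic times [1 - y]
    equals [1 + y ^ 2 * (1 - 2 * y)]. *)
Lemma expR_le_quadratic (y : R) : y <= 2^-1 -> expR y <= 1 + y + 2 * y ^+ 2.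
Proof.
move=> y2; have y1 : 0 < 1 - y by lra.
have : expR y <= (1 - y)^-1.
  have := expR_ge1Dx (- y); rewrite expRN => h.
  by rewrite -[leLHS]invrK lef_pV2 ?posrE ?invr_gt0 ?expR_gt0.
move/le_trans; apply; rewrite -[leLHS]mul1r ler_pdivrMr//.
have : 0 <= y ^+ 2 * (1 - 2 * y) by rewrite mulr_ge0 ?sqr_ge0//; lra.
by rewrite expr2; nra.
Qed.

Lemma bernoulli_mgf (q0 q1 v th : R) : 0 <= q0 -> 0 <= q1 -> q1 + q0 = 1 ->
  `|v| <= 1 -> 0 <= th -> th <= 2^-1 ->
  q1 * expR (th * v) + q0 <= expR (th * (v * q1) + 2 * th ^+ 2).
Proof.
move=> q00 q10 qE; rewrite ler_norml => /andP[v1 v2] th0 th1.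
have h : expR (th * v) <= 1 + th * v + 2 * (th * v) ^+ 2.
  by apply: expR_le_quadratic; nra.
apply: (le_trans _ (expR_ge1Dx _)).
have : q1 * expR (th * v) <= q1 * (1 + th * v + 2 * (th * v) ^+ 2).
  by rewrite ler_wpM2l.
have : q1 * (th * v) ^+ 2 <= th ^+ 2.
  have v21 : v ^+ 2 <= 1 by rewrite expr2; nra.
  rewrite exprMn mulrCA ler_piMr ?sqr_ge0// -[leRHS]mul1r ler_pM ?sqr_ge0//.
  by lra.
have -> : q0 = 1 - q1 by lra.
by nra.
Qed.

(** Exponential Chebyshev inequality with parameter [th * N]; the factor [N] compensates
    [|w k| <= N^-1]. The choice [th = eta / 8] minimises [2 * th ^ 2 - th * eta / 2], with value
    [- eta ^ 2 / 32]. The mean may exceed [al] by [eta / 2]: this is the room left for the influence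
    of the starting configuration. *)
Lemma chernoff (K : finType) (q : K -> bool -> R) (w : K -> R) (N al eta : R) :
  0 < N -> #|K|%:R = N -> 0 < eta -> eta <= 1 ->
  (forall k b, 0 <= q k b) -> (forall k, q k true + q k false = 1) ->
  (forall k, `|w k| <= N^-1) ->
  \sum_k w k * q k true <= al + eta / 2 ->
  \sum_(c : {ffun K -> bool} | al + eta <= \sum_k (c k)%:R * w k)
    \prod_k q k (c k) <= expR (- (N * (eta ^+ 2 / 32))).
Proof.
move=> N0 KN e0 e1 q0 qE wN mean; set th := eta / 8.
have th0 : 0 <= th by rewrite /th; lra.
have th1 : th <= 2^-1 by rewrite /th; lra.
pose S := fun c : {ffun K -> bool} => \sum_k (c k)%:R * w k.
apply: (@le_trans _ _ (\sum_(c : {ffun K -> bool})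
    \prod_k (q k (c k) * expR (th * N * ((c k)%:R * w k))) *
      expR (- (th * N * (al + eta))))).
  rewrite [leRHS](bigID (fun c : {ffun K -> bool} => al + eta <= S c))/=.
  rewrite -[leLHS]addr0 lerD//; last first.
    apply: sumr_ge0 => c _; rewrite mulr_ge0 ?expR_ge0//.
    by apply: prodr_ge0 => k _; rewrite mulr_ge0 ?expR_ge0.
  apply: ler_sum => c cal; rewrite big_split/= -[leRHS]mulrA ler_peMr//.
    exact: prodr_ge0.
  rewrite -expR_sum -mulr_sumr -expRD -[leLHS]expR0 ler_expR -mulrBr.
  by rewrite mulr_ge0 ?subr_ge0// mulr_ge0// ltW.
rewrite -mulr_suml.
(* The tilted sum over all configurations factorises into one two-term sum per coordinate. *)
rewrite -(bigA_distr_bigA (fun k b => q k b * expR (th * N * (b%:R * w k)))).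
have fac k : \sum_(b : bool) q k b * expR (th * N * (b%:R * w k)) <=
    expR (th * (N * w k * q k true) + 2 * th ^+ 2).
  rewrite big_bool /= mul1r mul0r mulr0 expR0 mulr1 -mulrA.
  apply: bernoulli_mgf => //.
  by rewrite normrM gtr0_norm// -(mulfV (lt0r_neq0 N0)) ler_pM2l.
apply: (@le_trans _ _ (expR (\sum_k (th * (N * w k * q k true) + 2 * th ^+ 2)) *
    expR (- (th * N * (al + eta))))).
  rewrite ler_wpM2r ?expR_ge0// expR_sum; apply: ler_prod => k _.
  by rewrite fac andbT sumr_ge0// => b _; rewrite mulr_ge0 ?expR_ge0.
rewrite -expRD ler_expR big_split/= sumr_const -[_ *+ #|_|]mulr_natr KN -mulr_sumr.
under eq_bigr do rewrite -mulrA.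
rewrite -mulr_sumr.
have : th * (N * (\sum_k w k * q k true)) <= th * (N * (al + eta / 2)).
  by rewrite ler_wpM2l// ler_wpM2l// ltW.
have -> : - (N * (eta ^+ 2 / 32)) =
    th * (N * (al + eta / 2)) + 2 * th ^+ 2 * N - th * N * (al + eta).
  by rewrite /th; field.
by move=> ?; lra.
Qed.

End chernoff.

(** * Probabilities as real numbers *)

Section probability.
Context d (Omega : measurableType d) (R : realType) (P : probability Omega R).
Implicit Types A B : set Omega.

Definition Pr A : R := fine (P A).

Lemma PrE A : measurable A -> P A = (Pr A)%:E.
Proof. by move=> mA; rewrite fineK// fin_num_measure. Qed.

Lemma Pr_ge0 A : 0 <= Pr A.
Proof. by rewrite fine_ge0. Qed.

Lemma Pr_le A B : measurable A -> measurable B -> A `<=` B -> Pr A <= Pr B.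
Proof.
by move=> mA mB AB; rewrite -lee_fin -!PrE// le_measure ?inE.
Qed.

Lemma Pr_le1 A : measurable A -> Pr A <= 1.
Proof. by move=> mA; rewrite -lee_fin -PrE// probability_le1. Qed.

Lemma PrT : Pr setT = 1.
Proof. by rewrite /Pr probability_setT. Qed.

Lemma Pr_disjointU A B : measurable A -> measurable B -> A `&` B = set0 ->
  Pr (A `|` B) = Pr A + Pr B.
Proof.
move=> mA mB AB; apply: EFin_inj; rewrite EFinD -!PrE//; last exact: measurableU.
by rewrite measureU.
Qed.

Lemma Pr_bigcup_le (I : eqType) (s : seq I) (F : I -> set Omega) A :
  measurable A -> (forall i, i \in s -> measurable (F i)) ->
  (forall w, A w -> exists2 i, i \in s & F i w) ->
  Pr A <= \sum_(i <- s) Pr (F i).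
Proof.
elim: s A => [|i s ih] A mA mF AF.
  rewrite big_nil (_ : A = set0) ?/Pr ?measure0//.
  by rewrite -subset0 => w /AF[].
rewrite big_cons; have mFi : measurable (F i) by apply: mF; rewrite mem_head.
have -> : A = (A `&` F i) `|` (A `\` F i) by rewrite setUIDK.
rewrite Pr_disjointU; [|exact: measurableI|exact: measurableD|]; last first.
  by rewrite -subset0 => w [[_ ?] [_]].
apply: lerD; first by apply: Pr_le => //; exact: measurableI.
apply: ih; first exact: measurableD.
  by move=> j js; apply: mF; rewrite inE js orbT.
move=> w [/AF[j +] Fj nF]; rewrite inE => /orP[/eqP ji|js]; last by exists j.
by exfalso; apply: nF; rewrite -ji.
Qed.

Lemma Pr_partition (C : finType) (Y : Omega -> C) B (U : pred C) :
  (forall c, measurable [set w | Y w = c]) -> measurable B ->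
  Pr (B `&` [set w | U (Y w)]) = \sum_(c | U c) Pr (B `&` [set w | Y w = c]).
Proof.
move=> mY mB.
have gen (s : seq C) : uniq s -> measurable (B `&` [set w | Y w \in s]) /\
    Pr (B `&` [set w | Y w \in s]) = \sum_(c <- s) Pr (B `&` [set w | Y w = c]).
  elim: s => [_|c s ih /= /andP[cs us]].
    rewrite big_nil (_ : [set w | Y w \in [::]] = set0) ?setI0 /Pr ?measure0//.
    by rewrite -subset0 => w.
  have [mI PI] := ih us.
  have -> : B `&` [set w | Y w \in c :: s] =
      (B `&` [set w | Y w = c]) `|` (B `&` [set w | Y w \in s]).
    rewrite -setIUr; congr (_ `&` _); apply/seteqP; split=> w /=.
      by rewrite inE => /orP[/eqP|]; [left|right].
    by rewrite inE => -[->|->]; rewrite ?eqxx ?orbT.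
  have mc : measurable (B `&` [set w | Y w = c]) by exact: measurableI.
  split; first exact: measurableU.
  rewrite big_cons Pr_disjointU// ?PI// -subset0 => w /= [[_ ->] [_ ]].
  by rewrite (negPf cs).
have := (gen (enum U) (enum_uniq _)).2; rewrite big_enum_cond/=.
rewrite (_ : [set w | Y w \in enum U] = [set w | U (Y w)]); last first.
  by apply/seteqP; split=> w /=; rewrite mem_enum.
by move=> ->; apply: eq_bigl => c; rewrite andbT.
Qed.

Lemma measurable_finite_preimage (C : finType) (Y : Omega -> C) (U : set C) :
  (forall c, measurable [set w | Y w = c]) -> measurable [set w | U (Y w)].
Proof.
move=> mY; rewrite (_ : [set w | U (Y w)] = \bigcup_(c in U) [set w | Y w = c]).
  by apply: fin_bigcup_measurable => //; exact: finite_finset.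
by apply/seteqP; split=> [w Uw|w [c Uc /= ->]//]; exists (Y w).
Qed.

End probability.

(** * Independent chains on a time grid *)

Section chains.
Context d (Omega : measurableType d) (R : realType) (P : probability Omega R).
Context (T : R) (K : finType) (X : K -> Omega -> cadlag_path T bool)
  (p : K -> R -> R -> bool -> bool -> R).

Local Notation Pr := (Pr P).

Definition conf (t : time T) (w : Omega) : {ffun K -> bool} := [ffun k => X k w t].

(** Transition kernel of the whole configuration, a product because the chains are independent. *)
Definition kern (s t : time T) (c c' : {ffun K -> bool}) : R :=
  \prod_k p k (time_val s) (time_val t) (c k) (c' k).

Hypothesis X_meas : forall k t, measurable_fun setT (fun w => X k w t).
Hypothesis X_markov : forall k (s t : time T) (A : set Omega) x y,
  time_val s <= time_val t -> past_events (X k) s A ->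
  P (A `&` [set w | X k w s = x] `&` [set w | X k w t = y]) =
  ((p k (time_val s) (time_val t) x y)%:E * P (A `&` [set w | X k w s = x]))%E.
Hypothesis X_indep : mutually_independent P X.

Lemma measurable_state k t x : measurable [set w | X k w t = x].
Proof.
rewrite -[X in measurable X]setTI.
exact: (X_meas k t measurableT (Y := [set x]) I).
Qed.

Lemma measurable_conf t c : measurable [set w | conf t w = c].
Proof.
rewrite (_ : [set w | _] = \bigcap_(k in [set: K]) [set w | X k w t = c k]).
  apply: fin_bigcap_measurable; first exact: finite_finset.
  by move=> k _; exact: measurable_state.
apply/seteqP; split=> [w /= <- k _ /=|w /= h]; first by rewrite ffunE.
by apply/ffunP => k; rewrite ffunE h.
Qed.

Lemma measurable_conf_set t (U : set {ffun K -> bool}) :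
  measurable [set w | U (conf t w)].
Proof. by apply: measurable_finite_preimage => c; exact: measurable_conf. Qed.

Section cylinders.
Variables (tau : nat -> time T) (c : nat -> {ffun K -> bool}).
Hypothesis tau_mono : forall i j, (i <= j)%N -> time_val (tau i) <= time_val (tau j).

Let cylk k N := [set w | forall l, (l <= N)%N -> X k w (tau l) = c l k].

Lemma cylinder_sigma k N (G : set (set Omega)) :
  (forall l, (l <= N)%N -> G [set w | X k w (tau l) = c l k]) ->
  <<s G >> (cylk k N).
Proof.
move=> GN; have -> : cylk k N =
    \bigcap_(l in `I_N.+1) [set w | X k w (tau l) = c l k].
  by apply/seteqP; split=> w h l /= lN; apply: h.
pose S := g_sigma_algebraType G.
suff : @measurable _ S (\bigcap_(l in `I_N.+1) [set w | X k w (tau l) = c l k]) by [].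
apply: fin_bigcap_measurable; first exact: finite_II.
by move=> l /= lN; apply: sub_sigma_algebra; exact: GN.
Qed.

Lemma cylinder_measurable k N : measurable (cylk k N).
Proof.
have -> : cylk k N = \bigcap_(l in `I_N.+1) [set w | X k w (tau l) = c l k].
  by apply/seteqP; split=> w h l /= lN; apply: h.
apply: fin_bigcap_measurable; first exact: finite_II.
by move=> l _; exact: measurable_state.
Qed.

Lemma Pr_cylinder_coordinate k N : Pr (cylk k N.+1) =
  p k (time_val (tau N)) (time_val (tau N.+1)) (c N k) (c N.+1 k) * Pr (cylk k N).
Proof.
have past : past_events (X k) (tau N) (cylk k N).
  apply: cylinder_sigma => l lN; exists (tau l), (c l k); split => //.
  exact: tau_mono.
have cE : cylk k N `&` [set w | X k w (tau N) = c N k] = cylk k N.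
  by apply/setIidPl => w; apply.
have := X_markov (c N k) (c N.+1 k) (tau_mono (leqnSn N)) past.
rewrite cE => h; apply: EFin_inj; rewrite EFinM -!PrE; first last.
- exact: cylinder_measurable.
- exact: cylinder_measurable.
rewrite -h; congr (P _); apply/seteqP; split=> [w h'|w [h1 h2] l].
  by split; [move=> l lN; apply: h'; rewrite ltnW|exact: h'].
by rewrite leq_eqVlt => /orP[/eqP->//|/h1].
Qed.

Lemma Pr_cylinder N :
  Pr [set w | forall l, (l <= N)%N -> conf (tau l) w = c l] =
  \prod_k Pr (cylk k N).
Proof.
have -> : [set w | forall l, (l <= N)%N -> conf (tau l) w = c l] =
    \bigcap_(k in [set k | k \in [set: K]%SET]) cylk k N.
  apply/seteqP; split=> w h.
    by move=> k _ l lN; rewrite -(h l lN) ffunE.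
  by move=> l lN; apply/ffunP => k; rewrite ffunE (h k)//= finset.in_setT.
rewrite /Pr X_indep; last first.
  by move=> k _; apply: cylinder_sigma => l _; exists (tau l), (c l k).
rewrite (eq_bigr (fun k => (Pr (cylk k N))%:E)); last first.
  by move=> k _; apply: PrE; exact: cylinder_measurable.
by rewrite prodEFin /=; apply: eq_bigl => k; rewrite finset.in_setT.
Qed.

Lemma Pr_cylinderS N :
  Pr [set w | forall l, (l <= N.+1)%N -> conf (tau l) w = c l] =
  kern (tau N) (tau N.+1) (c N) (c N.+1) *
  Pr [set w | forall l, (l <= N)%N -> conf (tau l) w = c l].
Proof.
rewrite !Pr_cylinder -big_split/=.
by apply: eq_bigr => k _; exact: Pr_cylinder_coordinate.
Qed.

End cylinders.

Section grid.
Variable tau : nat -> time T.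
Hypothesis tau_mono : forall i j, (i <= j)%N -> time_val (tau i) <= time_val (tau j).

Definition visits (N : nat) (U : nat -> pred {ffun K -> bool}) : set Omega :=
  [set w | forall l, (l <= N)%N -> U l (conf (tau l) w)].

Lemma measurable_visits N U : measurable (visits N U).
Proof.
have -> : visits N U = \bigcap_(l in `I_N.+1) [set w | U l (conf (tau l) w)].
  by apply/seteqP; split=> w h l /= lN; apply: h.
apply: fin_bigcap_measurable; first exact: finite_II.
by move=> l _; apply: (measurable_conf_set (tau l) (fun c => is_true (U l c))).
Qed.

Let single (c : {ffun K -> bool}) : pred {ffun K -> bool} := fun e => e == c.

Let upd (U : nat -> pred {ffun K -> bool}) (M : nat) c (l : nat) :=
  if l == M then single c else U l.

Lemma visits_upd N (U : nat -> pred {ffun K -> bool}) M c : (M <= N)%N -> U M c ->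
  visits N (upd U M c) = visits N U `&` [set w | conf (tau M) w = c].
Proof.
move=> MN UMc; apply/seteqP; split=> [w h|w [h1 h2] l lN].
  have cM : conf (tau M) w = c.
    by have := h M MN; rewrite /upd eqxx /single => /eqP.
  split=> // l lN; have := h l lN; rewrite /upd.
  by case: eqP => [->|//] _; rewrite cM.
rewrite /upd; case: eqP => [->|_]; last exact: h1.
by rewrite h2 /single eqxx.
Qed.

Lemma Pr_visits_upd N (U : nat -> pred {ffun K -> bool}) M : (M <= N)%N ->
  Pr (visits N U) = \sum_(c | U M c) Pr (visits N (upd U M c)).
Proof.
move=> MN; have -> : visits N U = visits N U `&` [set w | U M (conf (tau M) w)].
  by apply/esym/setIidPl => w; apply.
rewrite (Pr_partition P (U M)); [|exact: measurable_conf|exact: measurable_visits].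
by apply: eq_bigr => c UMc; rewrite visits_upd.
Qed.

(* The events that fix the configuration at the times [tau M, ..., tau N] are
   disintegrated one time after the other, down to the cylinders ([M = 0]), to
   which independence applies. *)
Lemma Pr_visits_markov M N (U : nat -> pred {ffun K -> bool}) c c' : (M <= N)%N ->
  (forall l, (M <= l <= N.+1)%N -> exists e, U l = single e) ->
  U N = single c -> U N.+1 = single c' ->
  Pr (visits N.+1 U) = kern (tau N) (tau N.+1) c c' * Pr (visits N U).
Proof.
(* For [M = 0] the whole history is fixed. In the inductive step the configuration at time [M] is
   free, and summing over it reduces to events fixed from [M] on. *)
elim: M U => [|M ih] U MN Usingle UN UN1.
  have [e eE] : exists e : nat -> {ffun K -> bool},
      forall l, (l <= N.+1)%N -> U l = single (e l).
    have /choice[e eE] : forall l, exists e, (l <= N.+1)%N -> U l = single e.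
      move=> l; have [lN|lN] := boolP (l <= N.+1)%N.
        by have [e] := Usingle l lN; exists e.
      by exists c.
    by exists e.
  have cyl n : (n <= N.+1)%N -> visits n U =
      [set w | forall l, (l <= n)%N -> conf (tau l) w = e l].
    move=> nN; apply/seteqP; split=> w h l ln; have := h l ln;
      rewrite eE ?(leq_trans ln)// /single; [by move/eqP|by move=> ->].
  have single_inj a b : single a = single b -> a = b.
    by move=> /(congr1 (fun q => q a)); rewrite /single eqxx => /esym/eqP.
  have -> : c = e N by apply: single_inj; rewrite -UN eE.
  have -> : c' = e N.+1 by apply: single_inj; rewrite -UN1 eE.
  by rewrite !cyl// Pr_cylinderS.
rewrite !(@Pr_visits_upd _ U M) 1?(leq_trans (ltnW MN))// ?ltnW//.
rewrite mulr_sumr; apply: eq_bigr => b UMb.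
apply: ih; first exact: ltnW.
- move=> l /andP[Ml lN]; rewrite /upd; case: eqP => [_|lM]; first by exists b.
  by apply: Usingle; rewrite lN andbT ltn_neqAle Ml andbT eq_sym; apply/eqP.
- by rewrite /upd gtn_eqF.
- by rewrite /upd gtn_eqF// ltnW.
Qed.

(** Decompose along the configurations at the last two times: the kernel factors out, and its sum
    over the targets is at most [rho] uniformly in the configuration at [tau N]. *)
Lemma Pr_visitsS_le N (U : nat -> pred {ffun K -> bool}) (rho : R) :
  (forall c, U N c ->
     \sum_(c' | U N.+1 c') kern (tau N) (tau N.+1) c c' <= rho) ->
  Pr (visits N.+1 U) <= rho * Pr (visits N U).
Proof.
move=> kle; rewrite (@Pr_visits_upd N.+1 U N)// (@Pr_visits_upd N U N)//.
rewrite mulr_sumr; apply: ler_sum => c UNc.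
rewrite (@Pr_visits_upd N.+1 (upd U N c) N.+1)//.
have E l : l == N.+1 -> upd U N c l = U l.
  by move=> /eqP->; rewrite /upd gtn_eqF.
rewrite E//.
rewrite (eq_bigr (fun c' => kern (tau N) (tau N.+1) c c' * Pr (visits N (upd U N c)))).
  by rewrite -mulr_suml ler_wpM2r ?Pr_ge0 ?kle.
move=> c' Uc'; rewrite (@Pr_visits_markov N N _ c c')//.
- congr (_ * Pr _); apply/seteqP; split=> w h l lN; have := h l lN;
    by rewrite /upd (ltn_eqF (leq_ltn_trans lN (ltnSn N))).
- move=> l /andP[Nl]; rewrite leq_eqVlt => /orP[/eqP->|lN].
    by rewrite /upd eqxx; exists c'.
  have -> : l = N by apply/eqP; rewrite eqn_leq Nl andbT -ltnS.
  by rewrite /upd eqxx (ltn_eqF (ltnSn N)); exists c.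
- by rewrite /upd eqxx (ltn_eqF (ltnSn N)).
- by rewrite /upd eqxx.
Qed.

Lemma Pr_visits_le N (U : nat -> pred {ffun K -> bool}) (rho : nat -> R) : (forall l, 0 <= rho l) ->
  (forall l c, (l < N)%N -> U l c ->
     \sum_(c' | U l.+1 c') kern (tau l) (tau l.+1) c c' <= rho l) ->
  Pr (visits N U) <= \prod_(l < N) rho l.
Proof.
move=> rho0; elim: N => [|N ih] kle.
  by rewrite big_ord0 Pr_le1//; exact: measurable_visits.
rewrite big_ord_recr/= mulrC; apply: (@le_trans _ _ (rho N * Pr (visits N U))).
  by apply: Pr_visitsS_le => c; apply: kle.
by rewrite ler_wpM2l// ih// => l c lN; apply: kle; rewrite ltnW.
Qed.

End grid.

End chains.

(** * Open sets of paths *)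

Section time.
Variables (R : realType) (T : R).
Implicit Types (s t : time T) (a b e rho : R).

Lemma time_itv t : 0 <= time_val t <= T.
Proof. by have := valP t; rewrite inE /= in_itv. Qed.

Lemma mktime_subproof a : 0 <= a <= T -> a \in `[0, T]%classic.
Proof. by move=> h; rewrite inE /= in_itv. Qed.

Definition mktime a (h : 0 <= a <= T) : time T := exist _ a (mktime_subproof h).

Lemma time_nbhsP t (A : set (time T)) : nbhs t A <->
  exists2 e, 0 < e & forall s, `|time_val s - time_val t| < e -> A s.
Proof.
split.
  rewrite nbhsE => -[B [[C oC <-] Ct] BA].
  have /nbhs_ballP[e /= e0 eC] : nbhs (time_val t) C by exact: open_nbhs_nbhs.
  by exists e => // s se; apply: BA; apply: eC; rewrite /ball/= distrC.
move=> [e e0 eA].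
have c : {for t, continuous (@time_val R T)}.
  exact: (@initial_continuous _ _ (@set_val _ `[0, T]%classic)).
have h : nbhs t (@time_val R T @^-1` ball (time_val t) e).
  exact: c _ (nbhsx_ballx _ _ e0).
by apply: filterS h => s /=; rewrite /ball/= distrC; exact: eA.
Qed.

Lemma cadlag_right (S : topologicalType) (phi : cadlag_path T S) t (A : set S) :
  nbhs (phi t) A -> exists2 e, 0 < e &
    forall s, time_val t <= time_val s < time_val t + e -> A (phi s).
Proof.
move=> nA; have [+ _] := path_cadlag phi t => /(_ A nA).
rewrite /= /within/= => /time_nbhsP[e e0 eA]; exists e => // s.
rewrite le_eqVlt => /andP[/orP[/eqP/time_val_inj <- _|ts se]].
  exact: nbhs_singleton.
by apply: (eA s) => //; rewrite gtr0_norm ?subr_gt0// ltrBlDl.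
Qed.

Lemma cadlag_left (S : topologicalType) (phi : cadlag_path T S) t :
  exists l : S, forall A : set S, nbhs l A -> exists2 e, 0 < e &
    forall s, time_val t - e < time_val s < time_val t -> A (phi s).
Proof.
have [_ [l hl]] := path_cadlag phi t; exists l => A /hl.
rewrite /= /within/= => /time_nbhsP[e e0 eA]; exists e => // s /andP[se st].
by apply: (eA s) => //; rewrite distrC gtr0_norm ?subr_gt0// ltrBlDr -ltrBlDl.
Qed.

(** Right-continuity with values in a discrete space keeps each coordinate constant for a while
    after [t], and finitely many coordinates share such an interval. Conditions on all times thus
    reduce to rational times and [T]. *)
Lemma rational_right (K : finType) (X : K -> cadlag_path T bool) t e :
  0 < e -> time_val t < T ->
  exists q : rat, exists h : 0 <= (ratr q : R) <= T,
    time_val t < (ratr q : R) < time_val t + e /\ forall k, X k (mktime h) = X k t.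
Proof.
move=> e0 tT.
have /choice[r rP] : forall k, exists r : R, 0 < r /\
    forall s, time_val t <= time_val s < time_val t + r -> X k s = X k t.
  move=> k; have nX : nbhs (X k t) [set X k t] by exact/principal_filterP.
  by have [r r0 rX] := cadlag_right nX; exists r; split=> // s /rX.
pose m := \big[Num.min/Num.min e (T - time_val t)]_k r k.
have m0 : 0 < m.
  rewrite /m; elim/big_ind: _ => [|x y x0 y0|k _].
  - by rewrite lt_min e0 subr_gt0.
  - by rewrite lt_min x0.
  - by have [] := rP k.
have mr k : m <= r k by exact: bigmin_le.
have mb : m <= Num.min e (T - time_val t).
  exact: bigmin_le_id.
have [q] : exists q, (ratr q : R) \in `](time_val t), (time_val t + m)[.
  by have /rat_in_itvoo : time_val t < time_val t + m by rewrite ltrDl.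
rewrite in_itv/= => /andP[tq qm].
have me : m <= e by rewrite (le_trans mb)// ge_min lexx.
have mT : m <= T - time_val t by rewrite (le_trans mb)// ge_min lexx orbT.
have h : 0 <= (ratr q : R) <= T.
  have /andP[t0 _] := time_itv t; apply/andP; split.
    by apply: le_trans t0 _; exact: ltW.
  by move: qm mT; lra.
exists q, h; split; first by rewrite tq (lt_le_trans qm)// lerD2l.
move=> k; have [_ ] := rP k; apply; rewrite ltW//= (lt_le_trans qm)//.
by rewrite lerD2l.
Qed.

(** The window lies to the right of [t], except at [t = T], where it lies to the left. *)
Lemma time_window t e : 0 < T -> 0 < e -> exists u v : R,
  [/\ 0 <= u, u < v, v <= T, time_val t - e <= u & v <= time_val t + e].
Proof.
move=> T0 e0; have /andP[t0 tT] := time_itv t.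
have [tlt|] := ltP (time_val t) T.
  exists (time_val t), (Num.min T (time_val t + e)).
  split; rewrite ?ge_min ?lexx ?orbT//; last by rewrite gerBl ltW.
  by rewrite lt_min tlt ltrDl.
move=> Tt; have tE : time_val t = T by apply/eqP; rewrite eq_le tT.
exists (Num.max 0 (T - e)), T; rewrite tE.
split; rewrite ?le_max ?lexx ?orbT//; last by rewrite lerDl ltW.
by rewrite gt_max T0 gtrBl.
Qed.

Lemma time_grid (u v : R) (N : nat) : 0 <= u -> u < v -> v <= T -> (0 < N)%N ->
  exists tau : nat -> time T, exists gap, 0 < gap /\
  [/\ forall i j, (i <= j)%N -> time_val (tau i) <= time_val (tau j),
      forall l, (l < N)%N -> gap <= time_val (tau l.+1) - time_val (tau l) &
      forall l, u <= time_val (tau l) <= v].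
Proof.
move=> u0 uv vT N0; pose gap := (v - u) / N%:R.
have N0' : (0 : R) < N%:R by rewrite ltr0n.
have gap0 : 0 < gap by rewrite divr_gt0// subr_gt0.
have gapN : N%:R * gap = v - u by rewrite /gap mulrCA divff ?mulr1// gt_eqF.
(* [minn l N] freezes the grid after [N], so that the monotonicity and the bounds hold for every
   index. *)
have tauuv l : u <= u + (minn l N)%:R * gap <= v.
  rewrite lerDl mulr_ge0 ?(ltW gap0)//= -lerBrDl -gapN.
  by rewrite ler_wpM2r ?(ltW gap0)// ler_nat geq_minr.
have tauI l : 0 <= u + (minn l N)%:R * gap <= T.
  by have /andP[h1 h2] := tauuv l; rewrite (le_trans u0 h1) (le_trans h2 vT).
exists (fun l => mktime (tauI l)), gap; split => //; split => //.
  move=> i j ij; rewrite /time_val /= lerD2l ler_wpM2r ?(ltW gap0)// ler_nat.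
  by rewrite leq_min geq_minr (leq_trans (geq_minl _ _) ij).
move=> l lN; rewrite /time_val /= (minn_idPl lN) (minn_idPl (ltnW lN)) -natr1.
by rewrite le_eqVlt; apply/orP; left; apply/eqP; ring.
Qed.

Section tube.
Variable S : metricType R.
Variable F : S -> R.
Hypothesis F_Lip : forall x y, F y <= F x + mdist x y.

(* [P] is unspecified on nonmeasurable sets, so only open sets of paths with a
   visibly measurable preimage are used; the margin [dl] makes a tube open. *)
Definition tube a b rho : set (cadlag_path T S) :=
  [set psi | exists2 dl, 0 < dl & forall t, a - dl < time_val t < b + dl ->
     F (psi t) <= rho - dl].

Lemma tube_le a b rho psi t : tube a b rho psi -> a <= time_val t <= b ->
  F (psi t) <= rho.
Proof.
move=> [dl dl0 h] /andP[ta tb]; apply: le_trans (h t _) _; last by lra.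
by apply/andP; split; lra.
Qed.

(** A path within [dl / 2] of a path with margin [dl] keeps the margin [dl / 2]: the time change
    shifts times by less than [dl / 2], and [F] grows at most by the distance. *)
Lemma open_tube a b rho : open (tube a b rho).
Proof.
rewrite openE => psi [dl dl0 psidl]; apply/nbhs_ballP.
exists (dl / 2); first by rewrite /= divr_gt0.
move=> psi' [lam [[mu lamK muK] lamI] [r re h]].
exists (dl / 2); first by rewrite divr_gt0.
move=> t /andP[ta tb]; have [h1 h2] := h (mu t); rewrite muK in h1 h2.
have : F (psi (mu t)) <= rho - dl.
  apply: psidl; move: h1; rewrite ler_norml => /andP[h3 h4].
  by apply/andP; split; lra.
have := F_Lip (psi (mu t)) (psi' t); move: h2 re; lra.
Qed.

Lemma time_change_last lam (t : time T) : time_change lam ->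
  time_val t = T -> lam t = t.
Proof.
move=> [[mu lamK muK] lamI] tT; apply: time_val_inj; apply/eqP.
have /andP[_ le1] := time_itv (lam t).
rewrite eq_le tT le1 leNgt; apply/negP => lt1.
have /andP[_ le2] := time_itv (mu t).
have : time_val (mu t) <= time_val t by rewrite tT.
rewrite le_eqVlt => /orP[/eqP/time_val_inj mt|/lamI].
  by move: lt1; rewrite -{1}mt muK tT ltxx.
by rewrite muK tT ltNge le1.
Qed.

(** Every time change fixes [T], so evaluation there is Skorokhod continuous. A tube at [T] would
    not do for a path that jumps at [T], since its margin also constrains the times just before. *)
Lemma open_last rho (t : time T) : time_val t = T ->
  open [set psi : cadlag_path T S | F (psi t) < rho].
Proof.
move=> tT; rewrite openE => psi psit; apply/nbhs_ballP.
exists (rho - F (psi t)); first by rewrite /= subr_gt0.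
move=> psi' [lam lamP [r re h]] /=.
have := h t; rewrite (time_change_last lamP tT) => -[_ h2].
by have := F_Lip (psi t) (psi' t); move: h2 re psit; rewrite /=; lra.
Qed.

Context d (Omega : measurableType d) (K : finType)
  (X : K -> Omega -> cadlag_path T bool) (Y : Omega -> cadlag_path T S)
  (G : {ffun K -> bool} -> S).
Hypothesis X_meas : forall k t, measurable_fun setT (fun w => X k w t).
Hypothesis YE : forall w t, Y w t = G (conf X t w).

(** The event becomes countable in two reductions: margins of the form [n.+1%:R^-1], then rational
    times. The time [T] is kept apart because no rational time of the interval lies to its right. *)
Lemma measurable_tube a b rho : measurable [set w | tube a b rho (Y w)].
Proof.
have T0 : [set w | tube a b rho (Y w)] = \bigcup_n
    [set w | forall t, a - n.+1%:R^-1 < time_val t < b + n.+1%:R^-1 ->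
       F (Y w t) <= rho - n.+1%:R^-1].
  apply/seteqP; split=> [w [dl dl0 h]|w [n _ h]]; last first.
    by exists n.+1%:R^-1.
  have [n nd] := ltr_add_invr (y := 0) dl0; rewrite add0r in nd.
  exists n => // t; move: nd; set e := n.+1%:R^-1 => nd /andP[ta tb].
  apply: le_trans (h t _) _; last by rewrite lerB// ltW.
  by apply/andP; split; lra.
rewrite T0; apply: bigcupT_measurable => n; set e := n.+1%:R^-1.
have -> : [set w | forall t, a - e < time_val t < b + e -> F (Y w t) <= rho - e] =
    (\bigcap_q [set w | forall h : 0 <= (ratr q : R) <= T, a - e < (ratr q : R) < b + e ->
      F (G (conf X (mktime h) w)) <= rho - e]) `&`
    [set w | forall h : 0 <= T <= T, a - e < T < b + e ->
      F (G (conf X (mktime h) w)) <= rho - e].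
  apply/seteqP; split=> [w h|w [h1 h2] t /andP[ta tb]].
    by split=> [q _|] h' qI; rewrite -YE; apply: h.
  have /andP[t0 tT] := time_itv t; move: tT; rewrite le_eqVlt => /orP[/eqP tT|tT].
    have h' : 0 <= T <= T by rewrite lexx andbT -tT.
    have -> : t = mktime h' by apply: time_val_inj.
    by rewrite YE; apply: h2; rewrite -tT ta.
  have e'0 : 0 < b + e - time_val t by rewrite subr_gt0.
  have [q [hq [/andP[tq qt] Xq]]] := rational_right (X ^~ w) e'0 tT.
  rewrite YE; have -> : conf X t w = conf X (mktime hq) w.
    by apply/ffunP => k; rewrite !ffunE Xq.
  by apply: (h1 q) => //; rewrite (lt_trans ta)//=; lra.
have cond (c : R) : measurable [set w | forall h : 0 <= c <= T, a - e < c < b + e ->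
      F (G (conf X (mktime h) w)) <= rho - e].
  have [h0|nh] := pselect (is_true (0 <= c <= T)); last first.
    by rewrite [X in measurable X](_ : _ = setT)//; apply/seteqP; split=> // w _ ? ?.
  have [hc|nh] := pselect (is_true (a - e < c < b + e)); last first.
    by rewrite [X in measurable X](_ : _ = setT)//; apply/seteqP; split=> // w _ ? ?.
  rewrite [X in measurable X](_ : _ =
      [set w | [set c' | F (G c') <= rho - e] (conf X (mktime h0) w)]).
    exact: measurable_conf_set.
  apply/seteqP; split=> [w h|w h h' _]; first exact: h.
  by rewrite (_ : h' = h0)//; exact: bool_irrelevance.
apply: measurableI; last exact: cond.
(* The rationals are enumerated by [unpickle]; an index that codes no rational contributes
   [setT]. *)
have -> : \bigcap_q [set w | forall h : 0 <= (ratr q : R) <= T, a - e < (ratr q : R) < b + e ->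
      F (G (conf X (mktime h) w)) <= rho - e] =
    \bigcap_(i in [set: nat]) (oapp (fun q : rat => [set w | forall h : 0 <= (ratr q : R) <= T,
      a - e < (ratr q : R) < b + e -> F (G (conf X (mktime h) w)) <= rho - e]) setT (unpickle i)).
  apply/seteqP; split=> w h i _.
    by case: (unpickle i) => //= q; exact: (h q).
  by have := h (pickle i) I; rewrite pickleK.
apply: bigcapT_measurable => i; case: (unpickle i) => //= q; exact: cond.
Qed.

Lemma measurable_last rho t : measurable [set w | F (Y w t) < rho].
Proof.
rewrite (_ : [set w | _] = [set w | [set c | F (G c) < rho] (conf X t w)]).
  exact: measurable_conf_set.
by apply/seteqP; split=> w /=; rewrite YE.
Qed.

End tube.

End time.

(** * The weak topology *)

Section weak.
Variable R : realType.
Local Notation mu := (leb_square R).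
Local Notation leb := (@lebesgue_measure R).

Lemma lebesgue_Q n (i : 'I_n) : (0 < n)%N -> leb (Q i) = (n%:R^-1)%:E.
Proof.
move=> n0; have n0' : (0 : R) < n%:R by rewrite ltr0n.
have E : i.+1%:R / n%:R - i%:R / n%:R = n%:R^-1 :> R.
  by rewrite -mulrBl -natr1 addrAC subrr add0r mul1r.
have lt : i%:R / n%:R < i.+1%:R / n%:R :> R by rewrite -subr_gt0 E invr_gt0.
rewrite (_ : Q i = if val i == 0%N then `[i%:R / n%:R, i.+1%:R / n%:R]%classic
                else `]i%:R / n%:R, i.+1%:R / n%:R]%classic); last first.
  apply/seteqP; split=> x; rewrite /Q /=; case: eqP => [->|_] /=;
    by rewrite in_itv /= ?mul0r; move=> ?; apply/andP.
by case: ifP => _; rewrite lebesgue_measure_itv/= lte_fin lt -EFinD E.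
Qed.

Lemma leb2_Q n (i j : 'I_n) : (0 < n)%N ->
  leb2 R (Q i `*` Q j) = ((n * n)%:R^-1)%:E.
Proof.
move=> n0; transitivity (leb (Q i) * leb (Q j))%E.
  by apply: product_measure1E; exact: measurable_Q.
by rewrite !lebesgue_Q// -EFinM natrM invfM.
Qed.

Lemma Q_unit n (i : 'I_n) (x : R) : Q i x -> 0 <= x <= 1.
Proof.
move=> [lo hi]; have n0 : (0 < n)%N by case: n i {lo hi} => [[]|].
have n0' : (0 : R) < n%:R by rewrite ltr0n.
apply/andP; split.
  by move: lo; case: ifP => // _ /ltW; apply: le_trans; rewrite divr_ge0.
by rewrite (le_trans hi)// ler_pdivrMr// mul1r ler_nat.
Qed.

Lemma Q_unit_square n (i j : 'I_n) : Q i `*` Q j `<=` @unit_square R.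
Proof. by move=> z [/Q_unit z1 /Q_unit z2]; split; rewrite /= in_itv. Qed.

Lemma leb_square_setT : mu setT = 1%E.
Proof.
rewrite /leb_square /= /mrestr setTI.
transitivity (leb `[0%R, 1%R] * leb `[0%R, 1%R])%E.
  by apply: product_measure1E.
by rewrite lebesgue_measure_itv/= lte01 -EFinD subr0 mule1.
Qed.

Lemma leb_square_Q n (i j : 'I_n) : (0 < n)%N ->
  mu (Q i `*` Q j) = ((n * n)%:R^-1)%:E.
Proof.
move=> n0; rewrite /leb_square /= /mrestr setIidl ?leb2_Q//.
exact: Q_unit_square.
Qed.

Lemma measurable_QQ n (i j : 'I_n) : measurable (Q i `*` Q j : set (plane R)).
Proof. by apply: measurableX; exact: measurable_Q. Qed.

Lemma bounded_integrable (f : plane R -> R) (M : R) :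
  measurable_fun setT f -> (forall z, `|f z| <= M) ->
  mu.-integrable setT (EFin \o f).
Proof.
move=> mf fM; apply: measurable_bounded_integrable => //.
  by rewrite leb_square_setT ltry.
exists M; split; rewrite ?num_real// => M' MM' z _ /=.
by rewrite (le_trans (fM z))// ltW.
Qed.

Lemma bounded_Lfun (f : plane R -> R) (M : R) :
  measurable_fun setT f -> (forall z, `|f z| <= M) -> f \in Lfun mu 2%:E.
Proof.
move=> mf fM; rewrite inE; apply/andP; split; rewrite inE//=.
rewrite /finite_norm unlock poweR_lty//.
rewrite (eq_integral (fun z => (f z ^+ 2)%:E)); last first.
  by move=> z _; rewrite /= powR_mulrn// real_normK// num_real.
apply: integrable_lty => //; apply: (@bounded_integrable _ (M ^+ 2)).
  exact: measurable_funX.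
by move=> z; rewrite normrX lerXn2r// nnegrE// (le_trans _ (fM z)).
Qed.

Definition test_value (psi : plane R -> R) (h : S0 R) : R :=
  \int[mu]_z (sval h z * psi z).

Definition weight (psi : plane R -> R) n (k : 'I_n * 'I_n) : R :=
  \int[mu]_z (\1_(Q k.1 `*` Q k.2) z * psi z).

Section test_function.
Variable psi : plane R -> R.
Hypothesis psi_meas : measurable_fun setT psi.
Hypothesis psi_le1 : forall z, `|psi z| <= 1.

Lemma test_value_continuous (m : weak_metric R) (h : S0 R) (e : R) : 0 < e ->
  exists2 r, 0 < r & forall h', wdist m h h' < r ->
    `|test_value psi h - test_value psi h'| < e.
Proof.
move=> e0; pose g : LfunType mu (lee1n 2) := Lfun_Sub (lee1n 2) (bounded_Lfun psi_meas psi_le1).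
have c : {for (h : S0_weak R), continuous (@pairing R : S0_weak R -> _)}.
  exact: initial_continuous.
have cg := continuous_comp c (@proj_continuous _ (fun _ => R) g (pairing h)).
have := cg (ball (pairing h g) e) (nbhsx_ballx _ _ e0).
rewrite /= -/(nbhs (h : S0_weak R) [set h' | ball (pairing h g) e (pairing h' g)]).
by move=> /(wdist_weak m)[r r0 rP]; exists r => // h' /rP.
Qed.

Lemma weight_le n (k : 'I_n * 'I_n) : (0 < n)%N ->
  `|weight psi k| <= (n * n)%:R^-1.
Proof.
move=> n0; pose A := Q k.1 `*` Q k.2 : set (plane R).
have mA : measurable A by exact: measurable_QQ.
have mi : measurable_fun setT (\1_A : plane R -> R) by exact: measurable_indic.
have i1 : mu.-integrable setT (EFin \o (fun z => \1_A z * psi z)).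
  apply: (@bounded_integrable _ 1); first exact: measurable_funM.
  by move=> z; rewrite normrM indicE; case: (_ \in _);
    rewrite ?normr1 ?normr0 ?mul1r ?mul0r.
apply: le_trans (le_normr_Rintegral measurableT i1) _.
have i2 : mu.-integrable setT (EFin \o (\1_A : plane R -> R)).
  apply: (@bounded_integrable _ 1) => // z.
  by rewrite indicE; case: (_ \in _); rewrite ?normr1 ?normr0.
rewrite (_ : (n * n)%:R^-1 = \int[mu]_z \1_A z); last first.
  by rewrite /Rintegral integral_indic// setIT leb_square_Q.
apply: le_Rintegral => //.
  exact: (integrable_norm i1).
move=> z _; rewrite normrM indicE; case: (_ \in _);
  by rewrite ?normr1 ?normr0 ?mul1r ?mul0r.
Qed.

Lemma measurable_S0 (h : S0 R) : measurable_fun setT (sval h : plane R -> R).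
Proof. exact: (measurable_funPT (repr (sval h))). Qed.

Lemma graphon_ae n (c : 'I_n -> 'I_n -> bool) :
  ae_eq mu setT (sval (graphon R c)) (step (fun i j => (c i j)%:R)).
Proof.
set g := sval _; have /eqP : (\pi_{mfun_ mu, plane R >-> measurableTypeR R} (repr g) = g)%qT.
  exact: reprK.
by rewrite eqmodE => /asboolP.
Qed.

Lemma test_value_graphon n (c : 'I_n -> 'I_n -> bool) :
  test_value psi (graphon R c) = \sum_k (c k.1 k.2)%:R * weight psi k.
Proof.
have mstep := @measurable_step R n (fun i j => (c i j)%:R).
transitivity (\int[mu]_z (step (fun i j => (c i j)%:R) z * psi z)).
  congr fine; apply: ae_eq_integral => //.
  - apply/measurable_EFinP; apply: measurable_funM => //.
    exact: (measurable_S0 (graphon R c)).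
  - by apply/measurable_EFinP; apply: measurable_funM.
  - by apply: filterS (graphon_ae c) => z /(_ I) -> _.
have i0 (k : 'I_n * 'I_n) : mu.-integrable setT
    (EFin \o (fun z => \1_(Q k.1 `*` Q k.2 : set (plane R)) z * psi z)).
  apply: (@bounded_integrable _ 1).
    by apply: measurable_funM => //; apply: measurable_indic; exact: measurable_QQ.
  by move=> z; rewrite normrM indicE; case: (_ \in _);
    rewrite ?normr1 ?normr0 ?mul1r ?mul0r.
transitivity (fine (\int[mu]_z (\sum_(k : 'I_n * 'I_n)
   ((c k.1 k.2)%:R%:E * (\1_(Q k.1 `*` Q k.2) z * psi z)%:E)))%E).
  congr fine; apply: eq_integral => z _; rewrite /step pair_big/= mulr_suml -sumEFin.
  by apply: eq_bigr => k _; rewrite -EFinM mulrA.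
rewrite integral_sum//; last first.
  by move=> k; exact: (integrableZl measurableT _ (i0 k)).
have fin k := integrable_fin_num measurableT (i0 k).
rewrite -sum_fine; last first.
  by move=> k _; rewrite (integralZl measurableT (i0 k)) fin_numM// fin.
by apply: eq_bigr => k _; rewrite (integralZl measurableT (i0 k)) fineM.
Qed.

End test_function.
(** Test against [psi], the difference [g - f] clipped to [[-1, 1]]. Then [(g - f) * psi] is
    nonnegative and vanishes only where [f = g], so its integral [L g - L f] is positive. Clipping
    bounds the weight of a cell by its area. *)
Lemma S0_separation (m : weak_metric R) (f g : S0 R) : f <> g ->
  exists (L : S0 R -> R) (w : forall n, 'I_n * 'I_n -> R),
  [/\ forall n k, (0 < n)%N -> `|w n k| <= (n * n)%:R^-1,
      forall n (c : 'I_n -> 'I_n -> bool),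
        L (graphon R c) = \sum_k (c k.1 k.2)%:R * w n k,
      forall h e, 0 < e -> exists2 r, 0 < r &
        forall h', wdist m h h' < r -> `|L h - L h'| < e &
      L f < L g].
Proof.
move=> fg; pose dif z : R := sval g z - sval f z.
pose psi z := Num.max (-1) (Num.min 1 (dif z)).
have mdif : measurable_fun setT dif.
  by apply: measurable_funB; exact: measurable_S0.
have mpsi : measurable_fun setT psi.
  by apply: measurable_maxr => //; apply: measurable_minr.
have psi1 z : `|psi z| <= 1.
  rewrite ler_norml /psi le_max lexx /= ge_max ge_min lexx /=.
  by rewrite andbT; lra.
exists (test_value psi), (weight psi); split.
- by move=> n k n0; exact: weight_le.
- by move=> n c; exact: test_value_graphon.
- by move=> h e e0; exact: test_value_continuous.
have prod0 z : 0 <= dif z * psi z.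
  rewrite /psi; have [d0|d0] := leP 0 (dif z).
    by rewrite mulr_ge0// le_max le_min ler01 d0 orbT.
  rewrite nmulr_rge0//; rewrite ge_max ge_min (ltW d0) orbT andbT; lra.
(* A representative lies in [[0, 1]] only almost everywhere, so integrability comes from an almost
   everywhere comparison with [1]. *)
have S0int (h : S0 R) : mu.-integrable setT (EFin \o (fun z => sval h z * psi z)).
  have mh := measurable_S0 h.
  apply/integrableP; split.
    by apply/measurable_EFinP; exact: measurable_funM.
  apply: (@le_lt_trans _ _ (\int[mu]_z (cst 1%E z))%E); last first.
    by rewrite integral_cst// leb_square_setT mule1 ltry.
  apply: ae_ge0_le_integral => //.
    by apply: measurableT_comp => //; apply/measurable_EFinP; exact: measurable_funM.
  have /asboolP := valP h; apply: filterS => z /andP[h0 h1] _ /=.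
  rewrite lee_fin normrM ger0_norm// -[leRHS]mul1r ler_pM//.
rewrite lt_neqAle -subr_ge0.
have LE : test_value psi g - test_value psi f = \int[mu]_z (dif z * psi z).
  rewrite /test_value -RintegralB//; [|exact: S0int..].
  by apply: eq_Rintegral => z _; rewrite /dif mulrBl.
rewrite LE Rintegral_ge0 ?andbT//.
apply/eqP => Leq; apply: fg.
have mprod : measurable_fun setT (EFin \o (fun z => dif z * psi z)).
  by apply/measurable_EFinP; exact: measurable_funM.
have iprod : mu.-integrable setT (EFin \o (fun z => dif z * psi z)).
  have := integrableB measurableT (S0int g) (S0int f).
  by apply: eq_integrable => // z _; rewrite /= -EFinB mulrBl.
have int0 : (\int[mu]_z `|(dif z * psi z)%:E|)%E = 0%E.
  transitivity (\int[mu]_z (dif z * psi z)%:E)%E.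
    by apply: eq_integral => z _; rewrite gee0_abs// lee_fin.
  rewrite -[LHS]fineK; last exact: (integrable_fin_num measurableT iprod).
  by congr EFin; rewrite -/(Rintegral _ _ _) -LE Leq subrr.
have ae0 := (ae_eq_integral_abs mu measurableT mprod).1 int0.
apply: val_inj => /=; rewrite -[LHS]reprK -[RHS]reprK; apply/eqP.
rewrite eqmodE; apply/asboolP; apply: filterS ae0 => z /(_ I) /= [].
move=> /eqP; rewrite mulf_eq0 => /orP dp _.
suff : dif z = 0 by move/eqP; rewrite subr_eq0 => /eqP.
case: dp => /eqP// /eqP; rewrite /psi => p0.
have [d0|d0|//] := ltgtP (dif z) 0.
  move: p0; rewrite lt_eqF// gt_max ltrN10 /= gt_min d0 orbT//.
move: p0; rewrite gt_eqF// lt_max lt_min ltr01 d0 orbT//.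
Qed.
Lemma Q_cover n (x : R) : (0 < n)%N -> 0 <= x <= 1 -> exists i : 'I_n, Q i x.
Proof.
move=> n0 /andP[x0 x1]; have n0' : (0 : R) < n%:R by rewrite ltr0n.
have ex : exists i, x <= i.+1%:R / n%:R by exists n.-1; rewrite prednK// divff// gt_eqF.
pose i := ex_minn ex.
have [xi imin] : x <= i.+1%:R / n%:R /\ forall j, x <= j.+1%:R / n%:R -> (i <= j)%N.
  by rewrite /i; case: ex_minnP.
have ilt : (i < n)%N.
  by rewrite -(prednK n0) ltnS imin// prednK// divff// gt_eqF.
exists (Ordinal ilt); split => //=; case: eqP => // /eqP; rewrite -lt0n => i0.
rewrite ltNge; apply/negP => xle; have := imin i.-1; rewrite prednK// => /(_ xle).
by rewrite -[X in (X <= _)%N](prednK i0) ltnn.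
Qed.

Lemma stepE n (c : 'I_n -> 'I_n -> R) (z : plane R) i j :
  Q i z.1 -> Q j z.2 -> step c z = c i j.
Proof.
move=> qi qj; rewrite /step pair_big/= (bigD1 (i, j))//= indicE mem_set//.
rewrite mulr1 big1 ?addr0// => -[i' j'] /= ne; rewrite indicE memNset ?mulr0//.
move=> [/= qi' qj']; move: ne.
by rewrite (Q_inj qi' qi) (Q_inj qj' qj) eqxx.
Qed.

(** The full and the empty graph are thus the same two elements of [S0] at every size, and a set of
    paths independent of [n] can refer to them. *)
Lemma graphon_cst n (b : bool) : (0 < n)%N ->
  graphon R (fun _ _ : 'I_n => b) = graphon R (fun _ _ : 'I_1 => b).
Proof.
move=> n0; apply: val_inj => /=; apply/eqP; rewrite eqmodE; apply/asboolP.
have sq : {ae mu, forall z, unit_square z}.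
  exists (~` @unit_square R); split.
  - by apply: measurableC; exact: measurable_unit_square.
  - by rewrite /leb_square /= /mrestr setICl measure0.
  - by [].
apply: filterS sq => z [/= z1 z2] _; rewrite !in_itv/= in z1 z2.
have [i qi] := Q_cover n0 z1; have [j qj] := Q_cover n0 z2.
have [i' qi'] := Q_cover (ltn0Sn 0) z1; have [j' qj'] := Q_cover (ltn0Sn 0) z2.
by rewrite (stepE _ qi qj) (stepE _ qi' qj').
Qed.

Lemma graphon_full_empty :
  graphon R (fun _ _ : 'I_1 => true) <> graphon R (fun _ _ : 'I_1 => false).
Proof.
have m1 : measurable_fun setT (cst 1 : plane R -> R) by [].
have le1 (z : plane R) : `|cst (1 : R) z| <= 1 by rewrite /= normr1.
move=> /(congr1 (test_value (cst 1))); rewrite !(test_value_graphon m1 le1) /=.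
rewrite [RHS]big1; last by move=> k _; rewrite mul0r.
rewrite (bigD1 (ord0, ord0))//= big1 ?addr0 ?mul1r; last first.
  by move=> [i j] /=; rewrite !ord1 eqxx.
have -> : weight (cst 1) (ord0 : 'I_1, ord0 : 'I_1) =
    \int[mu]_z \1_(Q (ord0 : 'I_1) `*` Q (ord0 : 'I_1)) z.
  by apply: eq_Rintegral => z _; rewrite mulr1.
rewrite /Rintegral integral_indic; [|by []|exact: measurable_QQ].
by rewrite setIT leb_square_Q// /= invr1 => /eqP; rewrite oner_eq0.
Qed.

End weak.

(** * Total rates *)

Section sup_rates.
Variable R : realType.
Local Open Scope ereal_scope.

(* No measurability of [g]: the integral of a nonnegative function is a supremum
   over the simple functions below it. *)
Lemma ge0_le_integral_nonmeasurable d (S : measurableType d)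
    (mu : {measure set S -> \bar R}) (D E : set S) (f g : S -> \bar R) :
  (forall x, D x -> 0 <= f x) -> (forall x, E x -> 0 <= g x) ->
  (forall x, (f \_ D) x <= (g \_ E) x) ->
  \int[mu]_(x in D) f x <= \int[mu]_(x in E) g x.
Proof.
move=> f0 g0 fg; rewrite !ge0_integralE//; apply: le_ereal_sup => _ [h hf <-].
by exists h => // x; exact: le_trans (hf x) (fg x).
Qed.

Lemma sup_time_ge0 (T : R) (f : R -> R) : (0 <= T)%R ->
  (forall t, (0 <= t <= T)%R -> (0 <= f t)%R) -> 0 <= sup_time T f.
Proof.
move=> T0 f0; apply: (@le_trans _ _ (f 0%R)%:E); first by rewrite lee_fin f0// lexx.
by apply: ereal_sup_ubound; exists 0%R => //=; rewrite in_itv/= lexx.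
Qed.

Lemma le_sup_time (T : R) (f : R -> R) t : (0 <= t <= T)%R ->
  (f t)%:E <= sup_time T f.
Proof. by move=> tT; apply: ereal_sup_ubound; exists t => //=; rewrite in_itv. Qed.

Lemma sup_time_le (T : R) (f : R -> R) (M : \bar R) :
  (forall t, (0 <= t <= T)%R -> (f t)%:E <= M) -> sup_time T f <= M.
Proof. by move=> fM; apply: ge_ereal_sup => _ [t /= + <-]; rewrite in_itv => /fM. Qed.

Lemma integral_step n (B : 'I_n -> 'I_n -> R) : (0 < n)%N ->
  (forall i j, (0 <= B i j)%R) ->
  \int[leb2 R]_(z in @unit_square R) (step B z)%:E =
  ((\sum_(k : 'I_n * 'I_n) B k.1 k.2) / (n * n)%:R)%:E.
Proof.
move=> n0 B0; have mU := @measurable_unit_square R.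
under eq_integral do rewrite /step pair_big/= -sumEFin.
rewrite ge0_integral_sum//; last 2 first.
- move=> k; apply/measurable_EFinP; apply: measurable_funM => //.
  by apply: measurable_indic; exact: measurable_QQ.
- by move=> k z _; rewrite lee_fin mulr_ge0// indicE.
rewrite mulr_suml -sumEFin; apply: eq_bigr => k _.
under eq_integral do rewrite EFinM.
rewrite ge0_integralZl_EFin//; last first.
  by apply/measurable_EFinP; apply: measurable_indic; exact: measurable_QQ.
rewrite integral_indic//; last exact: measurable_QQ.
by rewrite setIidl ?leb2_Q//; exact: Q_unit_square.
Qed.

Section bound.
Variables (T : R) (beta : plane R -> R -> R)
  (betan : forall n : nat, 'I_n -> 'I_n -> R -> R).
Hypothesis T_gt0 : (0 < T)%R.
Hypothesis beta_ge0 : forall z t, unit_square z -> (0 <= t <= T)%R -> (0 <= beta z t)%R.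
Hypothesis betan_ge0 : forall n (i j : 'I_n) t, (0 <= t <= T)%R -> (0 <= betan i j t)%R.
Hypothesis betan_bounded : \forall n \near \oo, forall i j : 'I_n,
  exists M : R, forall t, (0 <= t <= T -> betan i j t <= M)%R.
Hypothesis beta_L1 : in_L1 (@unit_square R) (fun z => sup_time T (beta z)).
Hypothesis betan_cvg :
  \int[leb2 R]_(z in @unit_square R)
    sup_time T (fun t => `|step (fun i j : 'I_n => betan i j t) z - beta z t|%R)
  @[n --> \oo] --> 0.

(** The average of [B] over the cells is the integral of [step B]. Pointwise, the supremum of the
    discrete rate is at most that of [beta] plus that of the difference; the first has a finite
    integral, the second an integral at most [1] for large [n], hence the [+ 1] in the constant. *)
Lemma sum_sup_rates : exists C : R, \forall n \near \oo,
  exists B : 'I_n -> 'I_n -> R,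
    (forall i j t, (0 <= t <= T)%R -> (betan i j t <= B i j)%R) /\
    (\sum_(k : 'I_n * 'I_n) B k.1 k.2 <= C * (n * n)%:R)%R.
Proof.
have [g [gi gE]] := beta_L1.
have mU := @measurable_unit_square R.
have mg : measurable_fun (@unit_square R) g by case/integrableP: gi.
have gfin : \int[leb2 R]_(z in @unit_square R) `|g z| \is a fin_num.
  by rewrite ge0_fin_numE ?integral_ge0//; case/integrableP: gi.
exists (fine (\int[leb2 R]_(z in @unit_square R) `|g z|) + 1)%R.
have T0 := ltW T_gt0.
have small : \forall n \near \oo, \int[leb2 R]_(z in @unit_square R)
    sup_time T (fun t => `|step (fun i j : 'I_n => betan i j t) z - beta z t|%R) <= 1.
  have : \forall x \near (0 : \bar R), x <= 1.
    by apply: (@filterS _ _ _ [set x | x < 1]) => [x /ltW//|];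
      apply: open_nbhs_nbhs; split; [exact: open_ereal_lt_ereal|rewrite /= lte01].
  exact: betan_cvg.
near=> n; have n0 : (0 < n)%N by near: n; exact: nbhs_infty_gt.
have bounded_n : forall i j : 'I_n, exists M : R,
    forall t, (0 <= t <= T -> betan i j t <= M)%R by near: n.
have small_n : \int[leb2 R]_(z in @unit_square R)
    sup_time T (fun t => `|step (fun i j : 'I_n => betan i j t) z - beta z t|%R) <= 1.
  by near: n.
pose B (i j : 'I_n) := fine (sup_time T (betan i j)).
have BE i j : (B i j)%:E = sup_time T (betan i j).
  have [M MP] := bounded_n i j.
  have s0 : 0 <= sup_time T (betan i j).
    by apply: sup_time_ge0 => // t; exact: betan_ge0.
  rewrite fineK// ge0_fin_numE//; apply: (@le_lt_trans _ _ M%:E); last exact: ltry.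
  by apply: sup_time_le => t tT; rewrite lee_fin MP.
have B0 i j : (0 <= B i j)%R.
  by rewrite -lee_fin BE; apply: sup_time_ge0 => // t; exact: betan_ge0.
exists B; split; first by move=> i j t tT; rewrite -lee_fin BE; exact: le_sup_time.
pose D z := sup_time T (fun t => `|step (fun i j : 'I_n => betan i j t) z - beta z t|%R).
have D0 z : 0 <= D z by apply: sup_time_ge0.
have [N [mN N0 Nsub]] := gE.
(* [D] need not be measurable, so its integral cannot be split off by additivity. The measurable
   [phi] stands in for it: [step B <= |g| + phi] everywhere, and [phi <= D] on the square outside
   the null set [N]. *)
pose phi z := maxe 0 ((step B z)%:E - `|g z|).
have mstep : measurable_fun (@unit_square R) (fun z => (step B z)%:E).
  by apply/measurable_EFinP; apply: measurable_funTS; exact: measurable_step.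
have step0 z : (0 <= step B z)%R.
  rewrite /step; apply: sumr_ge0 => i _; apply: sumr_ge0 => j _.
  by rewrite mulr_ge0// indicE.
have mphi : measurable_fun (@unit_square R) phi.
  apply: measurable_maxe => //; apply: emeasurable_funB => //.
  exact: measurableT_comp.
have phi0 z : 0 <= phi z by rewrite le_max lexx.
have stepphi z : (step B z)%:E <= `|g z| + phi z.
  rewrite /phi; case: (g z) => [r| |] /=;
    [|by rewrite addye ?leey// gt_eqF// (lt_le_trans ltNy0)// le_max lexx..].
  rewrite -EFinB -EFin_max -EFinD lee_fin -lerBlDl le_max.
  by rewrite lexx orbT.
have phiD z : unit_square z -> ~ N z -> phi z <= D z.
  move=> Uz Nz; rewrite ge_max D0/=.
  have gz : sup_time T (beta z) = g z.
    by apply: contrapT => h; apply: Nz; apply: Nsub => /= /(_ Uz).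
  have g0 : 0 <= g z.
    by rewrite -gz; apply: sup_time_ge0 => // t tT; exact: beta_ge0.
  have [[z1 z2]] := (Uz : _ /\ _); rewrite /= !in_itv/= in z1 z2.
  have [i qi] := Q_cover n0 z1; have [j qj] := Q_cover n0 z2.
  rewrite (stepE _ qi qj) gee0_abs// BE.
  have le : sup_time T (betan i j) <= g z + D z.
    apply: sup_time_le => t tT; rewrite -gz.
    apply: (@le_trans _ _ ((beta z t)%:E + `|betan i j t - beta z t|%:E)).
      by rewrite -EFinD lee_fin -lerBlDl ler_norm.
    apply: leeD; first exact: le_sup_time.
    have := @le_sup_time T (fun t => `|step (fun i j : 'I_n => betan i j t) z - beta z t|%R) t tT.
    by rewrite (stepE _ qi qj).
  move: le g0; case: (g z) => [r| |] le g0 //; last by rewrite -BE /= leNye.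
  by rewrite leeBlDl.
have total : \int[leb2 R]_(z in @unit_square R) (step B z)%:E <=
    \int[leb2 R]_(z in @unit_square R) `|g z| + 1.
  have mUN : measurable (@unit_square R `\` N) by exact: measurableD.
  have sub : @unit_square R `\` N `<=` @unit_square R by exact: subDsetl.
  have mg' : measurable_fun (@unit_square R `\` N) (fun z => `|g z|).
    by apply: (measurable_funS mU sub); exact: measurableT_comp.
  have mphi' : measurable_fun (@unit_square R `\` N) phi.
    exact: measurable_funS mU sub mphi.
  rewrite (ge0_negligible_integral mN mU mstep _ N0); last first.
    by move=> z _; rewrite lee_fin.
  apply: (@le_trans _ _ (\int[leb2 R]_(z in @unit_square R `\` N) (`|g z| + phi z))).
    apply: ge0_le_integral => //.
    - by move=> z _; rewrite lee_fin.
    - exact: measurable_funS mU sub mstep.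
    - exact: emeasurable_funD.
  rewrite ge0_integralD//; apply: leeD.
    by apply: ge0_subset_integral => //; exact: measurableT_comp.
  apply: (@le_trans _ _ (\int[leb2 R]_(z in @unit_square R) D z)); last exact: small_n.
  apply: ge0_le_integral_nonmeasurable => // z.
  rewrite /patch; case: ifPn => [/set_mem[Uz Nz]|_]; last by case: ifP.
  by rewrite mem_set//; exact: phiD.
move: total; rewrite integral_step// -(fineK gfin) -EFinD lee_fin.
by rewrite ler_pdivrMr// ltr0n muln_gt0 n0.
Unshelve. all: by end_near.
Qed.

End bound.
End sup_rates.

(** * Estimates at a fixed size *)

Section estimates.
Context d (Omega : measurableType d) (R : realType) (P : probability Omega R).
Context (T : R) (K : finType) (X : K -> Omega -> cadlag_path T bool)
  (p : K -> R -> R -> bool -> bool -> R) (rate : K -> bool -> R -> R)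
  (x0 : K -> bool) (Lam : R) (B : K -> R).
Hypothesis T_ge0 : 0 <= T.
Hypothesis Lam_gt0 : 0 < Lam.
Hypothesis rate_meas : forall k y, measurable_fun `[0, T]%classic (rate k y).
Hypothesis rate_ge : forall k y t, 0 <= t <= T -> Lam <= rate k y t.
Hypothesis rate_le : forall k y t, 0 <= t <= T -> rate k y t <= B k.
Hypothesis p_tf : forall k, transition_function T (rate k) (p k).
Hypothesis X_meas : forall k t, measurable_fun setT (fun w => X k w t).
Hypothesis X_start : forall k w (t : time T), time_val t = 0 -> X k w t = x0 k.
Hypothesis X_markov : forall k (s t : time T) (A : set Omega) x y,
  time_val s <= time_val t -> past_events (X k) s A ->
  P (A `&` [set w | X k w s = x] `&` [set w | X k w t = y]) =
  ((p k (time_val s) (time_val t) x y)%:E * P (A `&` [set w | X k w s = x]))%E.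
Hypothesis X_indep : mutually_independent P X.

Local Notation Pr := (Pr P).
Local Notation kern := (kern p).
Local Notation conf := (conf X).

Lemma Pr_transition k (s t : time T) x y : time_val s <= time_val t ->
  Pr ([set w | X k w s = x] `&` [set w | X k w t = y]) =
  p k (time_val s) (time_val t) x y * Pr [set w | X k w s = x].
Proof.
move=> st; have ms := measurable_state X_meas k s x.
have mt := measurable_state X_meas k t y.
have setTP : past_events (X k) s setT.
  exact: (@measurableT _ (g_sigma_algebraType
    [set E | exists t x, time_val t <= time_val s /\ E = [set w | X k w t = x]])).
have := X_markov x y st setTP; rewrite setTI => h.
by apply: EFin_inj; rewrite EFinM -!PrE//; exact: measurableI.
Qed.

Section jumps.
Variable C : R.
Hypothesis B_le : forall k, B k <= C.

Let changes k (s t : time T) : set Omega :=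
  [set w | X k w s = true] `&` [set w | X k w t = false] `|`
  [set w | X k w s = false] `&` [set w | X k w t = true].

Lemma changesP k s t w : X k w s <> X k w t -> changes k s t w.
Proof.
rewrite /changes /=; case: (X k w s); case: (X k w t) => // _; by [left|right].
Qed.

Lemma measurable_changes k s t : measurable (changes k s t).
Proof. by apply: measurableU; apply: measurableI; exact: measurable_state. Qed.

Lemma changes_process_events k s t : process_events (X k) (changes k s t).
Proof.
pose G := [set E | exists t x, E = [set w | X k w t = x]].
pose S := g_sigma_algebraType G.
have mG t' x : @measurable _ S [set w | X k w t' = x].
  by apply: sub_sigma_algebra; exists t', x.
suff : @measurable _ S (changes k s t) by [].
by apply: measurableU; apply: measurableI.
Qed.

Lemma Pr_changes k (s t : time T) : time_val s <= time_val t ->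
  Pr (changes k s t) <= C * (time_val t - time_val s).
Proof.
move=> st; have m r x := measurable_state X_meas k r x.
have /andP[s0 _] := time_itv s; have /andP[_ tT] := time_itv t.
rewrite Pr_disjointU; [|exact: measurableI|exact: measurableI|]; last first.
  by rewrite -subset0 => w /= [[-> _] []].
rewrite !Pr_transition//.
have le x : p k (time_val s) (time_val t) x (~~ x) <= C * (time_val t - time_val s).
  apply: le_trans (transition_change Lam_gt0 (rate_meas k) (rate_ge k)
    (rate_le k) (p_tf k) x s0 st tT) _.
  by rewrite ler_wpM2r// subr_ge0.
have PT : Pr [set w | X k w s = true] + Pr [set w | X k w s = false] = 1.
  rewrite -Pr_disjointU//; last by rewrite -subset0 => w /= [->].
  rewrite -(PrT P); congr (Pr _); apply/seteqP; split=> // w _ /=.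
  by case: (X k w s); [left|right].
apply: (@le_trans _ _ (C * (time_val t - time_val s) * Pr [set w | X k w s = true] +
    C * (time_val t - time_val s) * Pr [set w | X k w s = false])).
  by apply: lerD; rewrite ler_wpM2r ?Pr_ge0//; exact: le.
by rewrite -mulrDr PT mulr1.
Qed.

Lemma Pr_changes2 k k' (s t : time T) : k != k' -> time_val s <= time_val t ->
  Pr (changes k s t `&` changes k' s t) <= (C * (time_val t - time_val s)) ^+ 2.
Proof.
move=> kk' st; have := X_indep (J := [set k; k']%SET) (A := fun k => changes k s t).
have pe i : i \in [set k; k']%SET -> process_events (X i) (changes i s t).
  by move=> _; exact: changes_process_events.
move=> /(_ pe).
rewrite (_ : \bigcap_(i in _) _ = changes k s t `&` changes k' s t); last first.
  apply/seteqP; split=> [w h|w [h1 h2] i /=].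
    by split; apply: h; rewrite /= !inE eqxx ?orbT.
  by rewrite !inE => /orP[/eqP->|/eqP->].
rewrite big_setU1 ?inE//= big_set1 => h.
have mI := measurableI _ _ (measurable_changes k s t) (measurable_changes k' s t).
have -> : Pr (changes k s t `&` changes k' s t) =
    Pr (changes k s t) * Pr (changes k' s t).
  by apply: EFin_inj; rewrite EFinM -!PrE//; exact: measurable_changes.
by rewrite expr2 ler_pM ?Pr_ge0// Pr_changes.
Qed.

(** On a grid of [N] steps, a passage from [Af] to [Ag] makes two distinct chains change within one
    step. By independence this has probability at most [(C * (b - a) / N) ^ 2] per pair and step;
    the union bound over [N] steps is of order [1 / N]. *)
Lemma jump_null (a b : R) (Af Ag : set {ffun K -> bool}) (E : set Omega)
    (aT : 0 <= a <= T) (bT : 0 <= b <= T) : a < b ->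
  (forall c c', Af c -> Ag c' -> exists k k', [/\ k != k', c k <> c' k & c k' <> c' k']) ->
  measurable E ->
  (forall w t, E w -> a <= time_val t <= b -> Af (conf t w) \/ Ag (conf t w)) ->
  (forall w, E w -> Af (conf (mktime aT) w) /\ Ag (conf (mktime bT) w)) ->
  Pr E = 0.
Proof.
move=> ab two mE EAB Eends; apply/eqP; rewrite eq_le Pr_ge0 andbT.
apply/ler_addgt0Pr => e e0; rewrite add0r.
pose M := (#|K| * #|K|)%:R * (C * (b - a)) ^+ 2.
have M0 : 0 <= M by rewrite mulr_ge0// sqr_ge0.
have [N N0 NM] : exists2 N : nat, (0 < N)%N & M / N%:R <= e.
  have NP := archi_boundP (divr_ge0 M0 (ltW e0)); set N := Num.bound _ in NP.
  have N0 : (0 : R) < N%:R by rewrite (le_lt_trans _ NP)// divr_ge0// ltW.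
  exists N; first by rewrite -(ltr_nat R).
  by rewrite ler_pdivrMr// mulrC -ler_pdivrMr// ltW.
apply: le_trans NM.
have N0' : (0 : R) < N%:R by rewrite ltr0n.
pose h := (b - a) / N%:R.
have hN : N%:R * h = b - a by rewrite /h mulrCA divff ?mulr1// gt_eqF.
have h0 : 0 < h by rewrite divr_gt0// subr_gt0.
have tauI i : (i <= N)%N -> 0 <= a + i%:R * h <= T.
  move=> iN; apply/andP; split.
    by have /andP[? _] := aT; rewrite addr_ge0// mulr_ge0// ltW.
  have : i%:R * h <= N%:R * h by rewrite ler_wpM2r ?ler_nat// ltW.
  by rewrite hN; have /andP[_] := bT; lra.
(* A point of [time T] carries a proof of its bounds, available only for [i <= N]; the value beyond
   is a default. *)
pose tau i : time T := if pselect (i <= N)%N is left iN then mktime (tauI i iN)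
  else mktime aT.
have tauE i : (i <= N)%N -> time_val (tau i) = a + i%:R * h.
  by move=> iN; rewrite /tau; case: pselect.
have tau0E : tau 0%N = mktime aT.
  by apply: time_val_inj; rewrite tauE// mul0r addr0.
have tauNE : tau N = mktime bT.
  apply: time_val_inj; rewrite tauE// hN.
  by rewrite /time_val /= addrC subrK.
have tauab i : (i <= N)%N -> a <= time_val (tau i) <= b.
  move=> iN; rewrite tauE// lerDl mulr_ge0//=; last exact: ltW.
  have : i%:R * h <= N%:R * h by rewrite ler_wpM2r ?ler_nat// ltW.
  by rewrite hN; lra.
have step i : (i < N)%N -> time_val (tau i.+1) - time_val (tau i) = h.
  by move=> iN; rewrite !tauE ?(ltnW iN)// -natr1; ring.
pose s : seq ('I_N * (K * K)) := [seq x <- enum {: 'I_N * (K * K)} | x.2.1 != x.2.2].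
pose F (x : 'I_N * (K * K)) := changes x.2.1 (tau x.1) (tau x.1.+1) `&`
  changes x.2.2 (tau x.1) (tau x.1.+1).
have mF x : measurable (F x) by apply: measurableI; exact: measurable_changes.
apply: (@le_trans _ _ (\sum_(x <- s) Pr (F x))).
  apply: Pr_bigcup_le => // w Ew; have [Aa Ab] := Eends w Ew.
  (* At the grid time before the first visit to [Ag], the configuration is in [Af], the only
     alternative. *)
  have exi : exists i, (i <= N)%N && `[< Ag (conf (tau i) w) >].
    by exists N; rewrite leqnn; apply/asboolP; rewrite tauNE.
  have [i /andP[iN /asboolP Agi] imin] := ex_minnP exi.
  have i0 : (0 < i)%N.
    rewrite lt0n; apply/eqP => i0; rewrite i0 tau0E in Agi.
    by have [k [k' [_ + _]]] := two _ _ Aa Agi.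
  have iN' : (i.-1 < N)%N by rewrite prednK.
  have Afi : Af (conf (tau i.-1) w).
    have [//|Agi'] := EAB w (tau i.-1) Ew (tauab _ (ltnW iN')).
    have := imin i.-1; rewrite ltnW//= => /(_ (asboolT Agi')).
    by rewrite -[X in (X <= _)%N](prednK i0) ltnn.
  have [k [k' [kk' ck ck']]] := two _ _ Afi Agi.
  exists (Ordinal iN', (k, k')); first by rewrite mem_filter kk' mem_enum.
  rewrite !ffunE in ck ck'.
  by split; apply: changesP; rewrite /= prednK.
rewrite big_filter big_enum_cond/=.
apply: (@le_trans _ _ (\sum_(x : 'I_N * (K * K) | x.2.1 != x.2.2) (C * h) ^+ 2)).
  apply: ler_sum => x xx; rewrite -(step _ (ltn_ord x.1)).
  apply: Pr_changes2 => //; rewrite -subr_ge0 step//; exact: ltW.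
apply: (@le_trans _ _ (\sum_(x : 'I_N * (K * K)) (C * h) ^+ 2)).
  by rewrite [leRHS](bigID (fun x => x.2.1 != x.2.2))/= lerDl sumr_ge0// => *;
    exact: sqr_ge0.
rewrite sumr_const card_prod card_ord card_prod -[leLHS]mulr_natr !natrM.
rewrite /M /h le_eqVlt; apply/orP; left; apply/eqP.
by field; rewrite gt_eqF.
Qed.

End jumps.

Lemma kern_ge0 (s t : time T) c c' : time_val s <= time_val t -> 0 <= kern s t c c'.
Proof.
move=> st; have /andP[s0 _] := time_itv s; have /andP[_ tT] := time_itv t.
apply: prodr_ge0 => k _.
by have [] := p_tf k (c k) (c' k) s0 st tT.
Qed.

Lemma sum_kern_le1 (s t : time T) c (U : pred {ffun K -> bool}) :
  time_val s <= time_val t -> \sum_(c' | U c') kern s t c c' <= 1.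
Proof.
move=> st; have /andP[s0 _] := time_itv s; have /andP[_ tT] := time_itv t.
apply: (@le_trans _ _ (\sum_c' kern s t c c')).
  rewrite [leRHS](bigID U)/= lerDl sumr_ge0// => c' _; exact: kern_ge0.
rewrite -(bigA_distr_bigA (fun k y => p k (time_val s) (time_val t) (c k) y)).
rewrite big1// => k _; rewrite big_bool /=.
by have [] := p_tf k (c k) true s0 st tT.
Qed.

Section deviation.
Variables (N al eta : R) (w : K -> R) (n : nat) (tau : nat -> time T) (gap : R).
Hypothesis N_gt0 : 0 < N.
Hypothesis card_K : #|K|%:R = N.
Hypothesis eta_gt0 : 0 < eta.
Hypothesis eta_le1 : eta <= 1.
Hypothesis w_le : forall k, `|w k| <= N^-1.
Hypothesis tau_mono : forall i j, (i <= j)%N -> time_val (tau i) <= time_val (tau j).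
Hypothesis gap_gt0 : 0 < gap.
Hypothesis tau_gap : forall l, (l < n)%N -> gap <= time_val (tau l.+1) - time_val (tau l).
Hypothesis mixing : (2 * Lam * gap)^-1 <= eta / 2.

(** The mean of the functional at [tau l.+1] from the empty configuration at [tau l]. The starting
    point is a mere reference: any other one changes the mean by at most [eta / 2]. *)
Definition reference_mean (l : nat) : R :=
  \sum_k w k * p k (time_val (tau l)) (time_val (tau l.+1)) false true.

Lemma mean_forget l c : (l < n)%N ->
  `|\sum_k w k * p k (time_val (tau l)) (time_val (tau l.+1)) (c k) true
    - reference_mean l| <= eta / 2.
Proof.
move=> ln; rewrite /reference_mean -sumrB.
apply: le_trans (ler_norm_sum _ _ _) _.
apply: (@le_trans _ _ (\sum_(k : K) N^-1 * (eta / 2))); last first.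
  by rewrite sumr_const -[leLHS]mulr_natl card_K mulrA divff ?mul1r// gt_eqF.
apply: ler_sum => k _; rewrite -mulrBr normrM ler_pM//.
have /andP[s0 _] := time_itv (tau l); have /andP[_ tT] := time_itv (tau l.+1).
have g := tau_gap ln.
have st : time_val (tau l) < time_val (tau l.+1).
  by rewrite -subr_gt0 (lt_le_trans gap_gt0).
have h := transition_forget Lam_gt0 (rate_meas k) (rate_ge k)
    (rate_le k) (p_tf k) (c k) s0 st tT.
apply: le_trans h _; apply: le_trans mixing.
by rewrite lef_pV2 ?posrE ?mulr_gt0 ?subr_gt0// ler_pM2l ?mulr_gt0.
Qed.

(** Each step whose reference mean is at most [al] forces a deviation, whatever the previous
    configuration, and costs a factor [rho]; the other steps are bounded by [1]. *)
Lemma deviation (E : set Omega) : measurable E ->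
  (forall v l, E v -> (0 < l <= n)%N -> al + eta <= \sum_k (conf (tau l) v k)%:R * w k) ->
  Pr E <= expR (- (N * (eta ^+ 2 / 32))) ^+
    (\sum_(l < n) (reference_mean l <= al)%R)%N.
Proof.
move=> mE Edev; set rho := expR _.
have rho1 : rho <= 1.
  rewrite /rho -[leRHS]expR0 ler_expR oppr_le0 mulr_ge0 ?(ltW N_gt0)//.
  by rewrite divr_ge0// sqr_ge0.
(* Time [0] is left free: a deviation is charged to the transition into its time. *)
pose U (l : nat) (c : {ffun K -> bool}) :=
  (l == 0)%N || (al + eta <= \sum_k (c k)%:R * w k).
have vm := measurable_visits X_meas tau n U.
apply: (@le_trans _ _ (Pr (visits X tau n U))).
  apply: Pr_le => // v Ev l ln; rewrite /U; case: eqP => //= /eqP l0.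
  by apply: Edev => //; rewrite lt0n l0.
pose r l := if reference_mean l <= al then rho else 1.
apply: (@le_trans _ _ (\prod_(l < n) r l)).
  apply: (Pr_visits_le X_meas X_markov X_indep tau_mono).
    by move=> l; rewrite /r; case: ifP => _; rewrite ?expR_ge0.
  move=> l c ln _; rewrite /r; case: ifP => [mal|_]; last first.
    by apply: sum_kern_le1; exact: tau_mono.
  have /andP[s0 _] := time_itv (tau l); have /andP[_ tT] := time_itv (tau l.+1).
  have st := tau_mono (leqnSn l).
  apply: (chernoff (q := fun k => p k (time_val (tau l)) (time_val (tau l.+1)) (c k))) => //.
  - by move=> k b; have [] := p_tf k (c k) b s0 st tT.
  - by move=> k; have [] := p_tf k (c k) true s0 st tT.
  - have := mean_forget c ln; rewrite ler_distl => /andP[_ h].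
    by apply: le_trans h _; rewrite lerD2r.
rewrite le_eqVlt; apply/orP; left; apply/eqP.
rewrite (eq_bigr (fun l : 'I_n => rho ^+ (reference_mean l <= al)%R)).
  by rewrite prodrXr.
by move=> l _; rewrite /r; case: ifP => _; rewrite ?expr1 ?expr0.
Qed.

End deviation.

(** In each of the two phases an edge reaches its prescribed state with probability at least
    [(2 * D)^-1], where [D = (Lam + B k) / Lam]. As [2 * D <= expR (2 * D)], this is at least
    [expR (- (2 * D))]: the exponents add up to a quantity linear in [B], and the two phases give
    the factor [4]. *)
Lemma full_then_empty (s t : time T) (E : set Omega) :
  1 <= Lam / 2 * time_val s -> 1 <= Lam / 2 * (time_val t - time_val s) ->
  measurable E ->
  (forall w, conf s w = [ffun=> true] -> conf t w = [ffun=> false] -> E w) ->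
  expR (- (4 * (\sum_k (Lam + B k) / Lam))) <= Pr E.
Proof.
move=> long0 long1 mE subE.
have /andP[s0 sT] := time_itv s; have /andP[t0 tT] := time_itv t.
have st : time_val s <= time_val t.
  rewrite -subr_ge0 -(pmulr_rge0 _ (divr_gt0 Lam_gt0 (ltr0n _ 2))).
  exact: le_trans ler01 long1.
have z0 : 0 <= (0 : R) <= T by rewrite lexx.
pose tau (l : nat) := if l is l'.+1 then (if l' is 0%N then s else t) else mktime z0.
have tau_mono i j : (i <= j)%N -> time_val (tau i) <= time_val (tau j).
  have b l : time_val s <= time_val (tau l.+1) <= time_val t.
    by case: l => [|l] /=; rewrite ?lexx ?st.
  case: i => [|i]; case: j => [|j] //=.
    by move=> _; exact: (le_trans s0 (proj1 (andP (b j)))).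
  by case: i j => [|i] [|j].
pose c (l : nat) : {ffun K -> bool} :=
  if l is l'.+1 then (if l' is 0%N then [ffun=> true] else [ffun=> false])
  else [ffun k => x0 k].
have step := Pr_cylinderS X_meas X_markov X_indep c tau_mono.
have start : Pr [set w | forall l, (l <= 0)%N -> conf (tau l) w = c l] = 1.
  rewrite -(PrT P); congr (Pr _); apply/seteqP; split=> // w _ l.
  by rewrite leqn0 => /eqP->; apply/ffunP => k; rewrite !ffunE X_start.
have m2 : measurable [set w | forall l, (l <= 2)%N -> conf (tau l) w = c l].
  have -> : [set w | forall l, (l <= 2)%N -> conf (tau l) w = c l] =
      \bigcap_(l in `I_3) [set w | conf (tau l) w = c l].
    by apply/seteqP; split=> w h l /= lN; apply: h.
  by apply: fin_bigcap_measurable => // l _; exact: measurable_conf.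
apply: (@le_trans _ _ (Pr [set w | forall l, (l <= 2)%N -> conf (tau l) w = c l])); last first.
  by apply: Pr_le => // w h; apply: subE; [exact: (h 1%N)|exact: (h 2%N)].
rewrite !step start mulr1.
have low k : expR (- (2 * ((Lam + B k) / Lam))) <= Lam / (2 * (Lam + B k)).
  have B0 : 0 < Lam + B k.
    rewrite addr_gt0// (lt_le_trans Lam_gt0)//.
    exact: le_trans (rate_ge k true z0) (rate_le k true z0).
  have -> : Lam / (2 * (Lam + B k)) = (2 * ((Lam + B k) / Lam))^-1.
    by field; rewrite !gt_eqF.
  have D0 : 0 < (Lam + B k) / Lam by rewrite divr_gt0.
  rewrite expRN lef_pV2 ?posrE ?expR_gt0 ?mulr_gt0 ?invr_gt0//.
  by apply: (le_trans _ (expR_ge1Dx _)); rewrite lerDr.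
have prodle (u v : time T) a b : time_val u <= time_val v ->
    1 <= Lam / 2 * (time_val v - time_val u) ->
    expR (- (2 * (\sum_k (Lam + B k) / Lam))) <= kern u v a b.
  move=> uv long; have /andP[u0 _] := time_itv u; have /andP[_ vT] := time_itv v.
  rewrite /kern mulr_sumr -sumrN expR_sum; apply: ler_prod => i _.
  rewrite expR_ge0/=; apply: le_trans (low i) _.
  exact: (transition_lower Lam_gt0 (rate_meas i) (rate_ge i)
    (rate_le i) (p_tf i) (a i) (b i) u0 uv vT long).
have -> : - (4 * (\sum_k (Lam + B k) / Lam)) =
    - (2 * (\sum_k (Lam + B k) / Lam)) + - (2 * (\sum_k (Lam + B k) / Lam)) by ring.
rewrite expRD ler_pM ?expR_ge0//; apply: prodle => //=.
by rewrite /time_val /= subr0.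
Qed.

End estimates.

(** * Large deviations *)

Section ldp.
Context (R : realType) d (Omega : measurableType d) (P : probability Omega R)
  (S : topologicalType) (Y : nat -> Omega -> S) (b : nat -> R) (I : S -> \bar R).
Hypothesis b_gt0 : forall n, 0 < b n.
Hypothesis ldp : satisfies_LDP P Y b I.

(** The loss from [C] to [C + 1] turns a bound on a lower limit into one for all large [n]. *)
Lemma ldp_lower (G : set S) phi (C : R) : open G -> G phi -> (I phi <= C%:E)%E ->
  (forall n, measurable [set w | G (Y n w)]) ->
  \forall n \near \oo, expR (- ((C + 1) * b n)) <= Pr P [set w | G (Y n w)].
Proof.
move=> oG Gphi IC mG; have [_ /(_ _ oG) lb] := ldp.
have : ((- (C + 1))%:E < limn_einf (fun n => (b n)^-1%:E * lne (P [set w | G (Y n w)])))%E.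
  apply: lt_le_trans lb; apply: (@lt_le_trans _ _ (- C)%:E).
    by rewrite lte_fin; lra.
  rewrite EFinN leeN2; apply: le_trans IC; apply: ereal_inf_lbound.
  by exists phi.
rewrite /limn_einf lteNr -EFinN opprK => /ereal_inf_lt[_ [A Aoo <-] supA].
apply: filterS Aoo => n An.
have : (- ((b n)^-1%:E * lne (P [set w | G (Y n w)])) < (C + 1)%:E)%E.
  by apply: le_lt_trans supA; apply: ereal_sup_ubound; exists n.
rewrite lteNl -EFinN lte_pdivlMl// PrE// -EFinM.
case: (ltP 0 (Pr P [set w | G (Y n w)])) => [p0|p0]; last first.
  by rewrite le0_lneNy// lee_fin.
rewrite lne_EFin// lte_fin => /ltW h.
by rewrite -[leRHS]lnK ?posrE// ler_expR -mulNr mulrC.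
Qed.

(** Probabilities that do not decay on the scale [b n] force the infimum of [I] over [F] to be [0].
    It need not be attained here, hence the [dl]. *)
Lemma ldp_upper (F : set S) (dl : R) : closed F -> 0 < dl ->
  (forall n, measurable [set w | F (Y n w)]) ->
  (forall e, 0 < e -> \forall n \near \oo,
     expR (- (e * b n)) <= Pr P [set w | F (Y n w)]) ->
  exists2 phi, F phi & (I phi < dl%:E)%E.
Proof.
move=> cF dl0 mF large; have [/(_ _ cF) ub _] := ldp.
have : (ereal_inf [set I x | x in F] < dl%:E)%E.
  rewrite -lteN2; apply: lt_le_trans ub.
  apply: (@lt_le_trans _ _ (- (dl / 2))%:E).
    by rewrite -EFinN lte_fin; lra.
  apply: le_ereal_inf_tmp => _ [A Aoo <-].
  have dl2 : 0 < dl / 2 by lra.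
  have [n [An nP]] : exists n, A n /\
      expR (- (dl / 2 * b n)) <= Pr P [set w | F (Y n w)].
    by have [n [? ?]] := filter_ex (filterI Aoo (large _ dl2)); exists n.
  apply: (@le_trans _ _ ((b n)^-1%:E * lne (P [set w | F (Y n w)]))%E).
    have p0 : 0 < Pr P [set w | F (Y n w)] by apply: lt_le_trans nP; exact: expR_gt0.
    rewrite lee_pdivlMl// PrE// lne_EFin// -EFinM lee_fin.
    by rewrite -ler_expR lnK ?posrE// mulrN mulrC.
  by apply: ereal_sup_ubound; exists n.
by move=> /ereal_inf_lt[_ [phi Fphi <-]]; exists phi.
Qed.

End ldp.

(** * Distances as tube functionals, and continuity of paths *)

Section lipschitz.
Context (R : realType) (S : metricType R).

Lemma mdist_Lip (l x y : S) : mdist l y <= mdist l x + mdist x y.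
Proof. exact: metric_triangle. Qed.

Lemma mdistN_Lip (l x y : S) : - mdist l y <= - mdist l x + mdist x y.
Proof. by have := metric_triangle l y x; rewrite (metric_sym y x); lra. Qed.

Lemma mdist_min_Lip (l g x y : S) :
  Num.min (mdist l y) (mdist g y) <= Num.min (mdist l x) (mdist g x) + mdist x y.
Proof.
have := mdist_Lip l x y; have := mdist_Lip g x y.
have [_|_] := leP (mdist l x) (mdist g x) => h1 h2; rewrite ge_min.
  by rewrite h2.
by rewrite h1 orbT.
Qed.

Definition path_continuous (T : R) (phi : cadlag_path T S) := forall t0 r, 0 < r ->
  exists2 e, 0 < e & forall t, `|time_val t - time_val t0| < e -> mdist (phi t0) (phi t) < r.

(** Right-continuity being built in, only the left limits at positive times have to be compared with
    the values. *)
Lemma cadlag_continuous (T : R) (phi : cadlag_path T S) :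
  (forall (t0 : time T) (l : S), 0 < time_val t0 ->
    (forall r, 0 < r -> exists2 e, 0 < e & forall s,
       time_val t0 - e < time_val s < time_val t0 -> mdist l (phi s) < r) ->
    l = phi t0) ->
  path_continuous phi.
Proof.
move=> left t0 r r0.
have nb (h : S) q : 0 < q -> nbhs h [set h' | mdist h h' < q].
  by move=> q0; have := nbhsx_ballx h q q0; rewrite ballEmdist.
have [e2 e20 right] := cadlag_right (phi := phi) (t := t0) (nb (phi t0) r r0).
have [t00|t00] := ltP 0 (time_val t0); last first.
  exists e2 => // t tt; apply: right.
  have /andP[a _] := time_itv t.
  rewrite (le_trans t00 a)/=; move: tt; rewrite ltr_norml => /andP[_].
  by lra.
have [l lP] := cadlag_left phi t0.
have lE : l = phi t0.
  by apply: left => // q q0; have [e e0 eP] := lP _ (nb l q q0); exists e.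
rewrite lE in lP; have [e1 e10 leftP] := lP _ (nb _ _ r0).
exists (Num.min e1 e2); first by rewrite lt_min e10.
move=> t; rewrite lt_min => /andP[]; rewrite !ltr_norml => /andP[h1 h2] /andP[h3 h4].
have [tt|tt] := ltP (time_val t) (time_val t0).
  by apply: leftP; apply/andP; split; lra.
by apply: right; apply/andP; split; lra.
Qed.

Lemma mem_tube_near (T : R) (phi : cadlag_path T S) (l : S) (a b e rho : R) :
  0 < e -> 0 < rho ->
  (forall t, a - e < time_val t < b + e -> mdist l (phi t) < rho / 2) ->
  tube (mdist l) a b rho phi.
Proof.
move=> e0 rho0 near_l; exists (Num.min e (rho / 2)).
  by rewrite lt_min e0 divr_gt0.
move=> t /andP[ta tb]; set dl := Num.min _ _ in ta tb *.
have d1 : dl <= e by rewrite ge_min lexx.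
have d2 : dl <= rho / 2 by rewrite ge_min lexx orbT.
have : mdist l (phi t) < rho / 2 by apply: near_l; apply/andP; split; lra.
by lra.
Qed.

End lipschitz.

(** * The graph process under a large deviation principle *)

Section model.
Context (R : realType) (T : R)
  (betan : bool -> forall n : nat, 'I_n -> 'I_n -> R -> R) (c_beta : R)
  (a : nat -> R) (d : measure_display) (Omega : measurableType d)
  (P : probability Omega R) (x : forall n : nat, 'I_n -> 'I_n -> bool)
  (X : forall n : nat, 'I_n -> 'I_n -> Omega -> cadlag_path T bool)
  (m : weak_metric R).
Hypothesis T_gt0 : 0 < T.
Hypothesis betan_meas : forall s n (i j : 'I_n),
  measurable_fun `[0, T]%classic (betan s i j).
Hypothesis c_beta_gt0 : 0 < c_beta.
Hypothesis betan_ge : forall s n (i j : 'I_n) (t : R),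
  0 <= t <= T -> c_beta <= betan s i j t.
Hypothesis betan_reg : \forall n \near \oo, forall s (i j : 'I_n),
  bounded_left_continuous T (betan s i j).
Hypothesis a_gt0 : forall n, (0 < n)%N -> 0 < a n.
Hypothesis a_cvg : a n @[n --> \oo] --> +oo.
Hypothesis X_markov : forall n (i j : 'I_n),
  markov_chain P (fun s t => a n * betan s i j t) (x i j) (X i j).
Hypothesis X_indep : forall n,
  mutually_independent P (fun k : 'I_n * 'I_n => X k.1 k.2).

Let Xk n (k : 'I_n * 'I_n) := X k.1 k.2.
Let Y n w := graphon_path m (fun i j : 'I_n => X i j w).
Let Gr n (c : {ffun 'I_n * 'I_n -> bool}) : S0_metric m :=
  graphon R (fun i j => c (i, j)).

Lemma X_measurable (n : nat) (k : 'I_n * 'I_n) t :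
  measurable_fun setT (fun w => Xk k w t).
Proof. by case: (X_markov k.1 k.2) => + _ _; apply. Qed.

Lemma graphon_pathE (n : nat) w t : Y n w t = Gr (conf (@Xk n) t w).
Proof.
rewrite /Y /Gr /=; congr (graphon R _).
by apply/funext => i; apply/funext => j; rewrite ffunE.
Qed.

Lemma transition_data n : exists p : 'I_n * 'I_n -> R -> R -> bool -> bool -> R,
  (forall k, transition_function T (fun s t => a n * betan s k.1 k.2 t) (p k)) /\
  (forall k (s t : time T) (A : set Omega) y z,
    time_val s <= time_val t -> past_events (Xk k) s A ->
    P (A `&` [set w | Xk k w s = y] `&` [set w | Xk k w t = z]) =
    ((p k (time_val s) (time_val t) y z)%:E * P (A `&` [set w | Xk k w s = y]))%E).
Proof.
have /choice[p pP] : forall k : 'I_n * 'I_n, exists p : R -> R -> bool -> bool -> R,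
    transition_function T (fun s t => a n * betan s k.1 k.2 t) p /\
    forall (s t : time T) (A : set Omega) y z,
    time_val s <= time_val t -> past_events (Xk k) s A ->
    P (A `&` [set w | Xk k w s = y] `&` [set w | Xk k w t = z]) =
    ((p (time_val s) (time_val t) y z)%:E * P (A `&` [set w | Xk k w s = y]))%E.
  by move=> k; case: (X_markov k.1 k.2) => _ _ [p p1 p2]; exists p.
by exists p; split=> k; have [] := pP k.
Qed.

Lemma rate_measurable n (k : 'I_n * 'I_n) s :
  measurable_fun `[0, T]%classic (fun t => a n * betan s k.1 k.2 t).
Proof. by apply: measurable_funM => //; exact: measurable_cst. Qed.

Lemma rate_lower n (k : 'I_n * 'I_n) s t : (0 < n)%N -> 0 <= t <= T ->
  a n * c_beta <= a n * betan s k.1 k.2 t.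
Proof. by move=> n0 tT; rewrite ler_pM2l ?a_gt0// betan_ge. Qed.

Lemma rates_bounded n : (forall s (i j : 'I_n), bounded_left_continuous T (betan s i j)) ->
  exists C : R, forall s (i j : 'I_n) t, 0 <= t <= T -> betan s i j t <= C.
Proof.
move=> reg; have /choice[M MP] : forall q : bool * ('I_n * 'I_n), exists M : R,
    forall t, 0 <= t <= T -> `|betan q.1 q.2.1 q.2.2 t| <= M.
  by move=> q; have [[M MP] _] := reg q.1 q.2.1 q.2.2; exists M.
exists (\big[Num.max/0]_q M q) => s i j t tT.
apply: (@le_trans _ _ (M (s, (i, j)))); last exact: le_bigmax.
by apply: le_trans (MP (s, (i, j)) t tT); exact: ler_norm.
Qed.

Context (b : nat -> R) (I : cadlag_path T (S0_metric m) -> \bar R).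
Hypothesis b_gt0 : forall n, 0 < b n.
Hypothesis I_rate : rate_function I.
Hypothesis ldp : satisfies_LDP P Y b I.

Local Notation tube_event F u v rho n := [set w | tube F u v rho (Y n w)].

Lemma tube_event_measurable (F : S0_metric m -> R) (u v rho : R) n :
  measurable (tube_event F u v rho n).
Proof. exact: (measurable_tube F (@X_measurable n) (@graphon_pathE n)). Qed.

Lemma separation_two_flips (L : S0_metric m -> R) (n : nat) (w : 'I_n * 'I_n -> R)
    (e : R) (c c' : {ffun 'I_n * 'I_n -> bool}) : (n * n)%:R^-1 <= e ->
  (forall k, `|w k| <= (n * n)%:R^-1) ->
  (forall c : {ffun 'I_n * 'I_n -> bool}, L (Gr c) = \sum_k (c k)%:R * w k) ->
  e < L (Gr c') - L (Gr c) ->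
  exists k k', [/\ k != k', c k <> c' k & c k' <> c' k'].
Proof.
move=> ne wn LE Lcc; have e0 : 0 <= e by rewrite (le_trans _ ne).
have [k ck] : exists k, c k <> c' k.
  apply: contrapT => none; move: Lcc; rewrite (_ : c = c') ?subrr ?ltNge ?e0//.
  by apply/ffunP => k; apply: contrapT => ck; apply: none; exists k.
apply: contrapT => none; move: Lcc; rewrite ltNge; apply/negP; rewrite negbK.
apply: le_trans (le_trans (wn k) ne); apply: le_trans (ler_norm _) _.
rewrite !LE (bigD1 k)//= [X in _ - X](bigD1 k)//=.
rewrite (eq_bigr (fun k' => (c k')%:R * w k')); last first.
  move=> k' kk'; suff -> : c k' = c' k' by [].
  by apply: contrapT => ck'; apply: none; exists k, k'; rewrite eq_sym kk'.
rewrite opprD addrACA subrr addr0 -mulrBl normrM.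
by move: ck; case: (c k); case: (c' k) => // _; rewrite ?subr0 ?sub0r ?normrN normr1 mul1r.
Qed.

Lemma inv_square_small (e : R) : 0 < e -> \forall n \near \oo,
  (0 < n)%N /\ (n * n)%:R^-1 <= e.
Proof.
move=> e0; near=> n.
have n0 : (0 < n)%N by near: n; exact: nbhs_infty_gt.
have n0' : (0 : R) < n%:R by rewrite ltr0n.
split=> //; have ne : e^-1 <= n%:R by near: n; exact: nbhs_infty_ger.
rewrite -[leRHS]invrK lef_pV2 ?posrE ?invr_gt0 ?ltr0n ?muln_gt0 ?n0//.
apply: le_trans ne _; rewrite ler_nat leq_pmull//.
Unshelve. all: by end_near.
Qed.

(* Two distinct graphons are at a fixed distance in some weak functional, which
   a single flip moves by at most [1 / n ^ 2]: going from near [l] to near [g]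
   without passing elsewhere takes two simultaneous flips. *)
Lemma no_jump (phi : cadlag_path T (S0_metric m)) (l g : S0_metric m) :
  l <> g -> exists2 rho0, 0 < rho0 & forall (rho u v C : R) (uT : 0 <= u <= T)
    (vT : 0 <= v <= T) (G : set (cadlag_path T (S0_metric m))),
  0 < rho < rho0 -> u < v -> open G -> G phi ->
  (forall n, measurable [set w | G (Y n w)]) ->
  (forall psi, G psi -> mdist g (psi (mktime vT)) <= rho) ->
  tube (fun h => Num.min (mdist l h) (mdist g h)) u v rho phi ->
  tube (mdist l) u u rho phi ->
  ~ (I phi <= C%:E)%E.
Proof.
move=> lg; have [L [w [wn LE Lc Llg]]] := S0_separation m lg.
(* The values at [l] and [g] are [3 * e] apart, so points within [e] of them in [L] still differ by
   more than [e], which exceeds the effect of one flip for large [n]. *)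
pose e := (L g - L l) / 3; have e0 : 0 < e by rewrite divr_gt0// subr_gt0.
have [r1 r10 Lc1] := Lc l e e0; have [r2 r20 Lc2] := Lc g e e0.
exists (Num.min r1 r2); first by rewrite lt_min r10.
move=> rho u v C uT vT G /andP[rho0 rho12] uv oG Gphi mG Gv phi_uv phi_u IC.
have [rho1 rho2] : rho < r1 /\ rho < r2 by move: rho12; rewrite lt_min => /andP.
(* [G] pins the path near [g] at time [v]. It stays abstract because it is a tube when [v < T] can
   be chosen after the jump, and a condition at the single time [T] otherwise. *)
pose U := G `&` tube (fun h => Num.min (mdist l h) (mdist g h)) u v rho
  `&` tube (mdist l) u u rho.
have oU : open U.
  apply: openI; [apply: openI => //|]; apply: open_tube.
    exact: mdist_min_Lip.
  exact: mdist_Lip.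
have mU n : measurable [set w | U (Y n w)].
  have := measurableI _ _ (measurableI _ _ (mG n)
    (tube_event_measurable (fun h => Num.min (mdist l h) (mdist g h)) u v rho n))
    (tube_event_measurable (mdist l) u u rho n).
  by [].
have low := ldp_lower b_gt0 ldp oU (conj (conj Gphi phi_uv) phi_u) IC mU.
have null : \forall n \near \oo, Pr P [set w | U (Y n w)] = 0.
  near=> n.
  have [n0 ne] : (0 < n)%N /\ (n * n)%:R^-1 <= e.
    by near: n; exact: inv_square_small.
  have reg : forall s (i j : 'I_n), bounded_left_continuous T (betan s i j) by near: n.
  (* This bound may depend on [n]: the probability is exactly [0] at each fixed size, so no
     uniformity is required. *)
  have [C0 C0P] := rates_bounded reg.
  have [p [p_tf p_markov]] := transition_data n.
  have a0 := a_gt0 n0.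
  apply: (@jump_null _ _ _ P T _ (@Xk n) p (fun k s t => a n * betan s k.1 k.2 t)
    (a n * c_beta) (fun=> a n * C0) _ _ _ _ p_tf (@X_measurable n) p_markov (@X_indep n)
    (a n * C0) _ u v (fun c => mdist l (Gr c) <= rho) (fun c => mdist g (Gr c) <= rho)
    _ uT vT uv _ (mU n)).
  - exact: mulr_gt0.
  - by move=> k s; exact: rate_measurable.
  - by move=> k s t; exact: rate_lower.
  - by move=> k s t tT; rewrite ler_pM2l// C0P.
  - by [].
  - move=> c c' lc gc; apply: (separation_two_flips (L := L) (w := @w n) ne).
    + by move=> k; exact: wn.
    + by move=> c''; rewrite LE; apply: eq_bigr => -[].
    + have := Lc1 (Gr c) (le_lt_trans lc rho1).
      have := Lc2 (Gr c') (le_lt_trans gc rho2).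
      rewrite !ltr_norml => /andP[h1 h2] /andP[h3 h4].
      have eE : 3 * e = L g - L l by rewrite /e mulrC divfK.
      by lra.
  - move=> w' t [[_ h] _] tuv.
    by have := tube_le h tuv; rewrite graphon_pathE ge_min => /orP.
  - move=> w' [[Gw _] h]; rewrite -!graphon_pathE; split; last exact: Gv.
    by apply: (tube_le h); rewrite /time_val /= lexx.
have [n [nlow nnull]] := filter_ex (filterI low null).
by move: nlow; rewrite nnull leNgt expR_gt0.
Unshelve. all: by end_near.
Qed.

Lemma finite_rate_continuous (phi : cadlag_path T (S0_metric m)) (C : R) :
  (I phi <= C%:E)%E -> path_continuous phi.
Proof.
move=> IC; apply: cadlag_continuous => t0 l t00 left; apply: contrapT => lg.
have [rho0 rho00 nj] := no_jump phi lg.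
pose rho := rho0 / 2; have rhoI : 0 < rho < rho0 by rewrite /rho; apply/andP; split; lra.
have rho_gt0 : 0 < rho by case/andP: rhoI.
have rho2 : 0 < rho / 2 by rewrite divr_gt0.
have [e1 e10 leftP] := left _ rho2.
have [e2 e20 rightP] : exists2 e, 0 < e & forall s,
    time_val t0 <= time_val s < time_val t0 + e -> mdist (phi t0) (phi s) < rho / 2.
  have nb := nbhsx_ballx (phi t0) _ rho2; rewrite ballEmdist in nb.
  exact: (cadlag_right (phi := phi) (t := t0) nb).
(* The quarter leaves room for [u = t0 - 2 * q] with a margin [q] on both sides, inside the interval
   where [phi] is near its left limit and inside [[0, T]]. *)
pose q := Num.min (Num.min e1 e2) (time_val t0) / 4.
have [q0 qe1 qe2 qt] : [/\ 0 < q, 4 * q <= e1, 4 * q <= e2 & 4 * q <= time_val t0].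
  have qE : 4 * q = Num.min (Num.min e1 e2) (time_val t0) by rewrite /q mulrC divfK.
  split; rewrite ?qE ?ge_min ?lexx ?orbT//.
  by rewrite divr_gt0// !lt_min e10 e20.
have /andP[_ t0T] := time_itv t0.
pose u := time_val t0 - 2 * q.
have uT : 0 <= u <= T by rewrite /u; apply/andP; split; lra.
have phi_u : tube (mdist l) u u rho phi.
  apply: (mem_tube_near q0 rho_gt0) => t /andP[h1 h2]; apply: leftP.
  by rewrite /u in h1 h2; apply/andP; split; lra.
have phi_uv v e : 0 < e -> v + e <= time_val t0 + e2 ->
    tube (fun h => Num.min (mdist l h) (mdist (phi t0) h)) u v rho phi.
  move=> e0 ve; exists (Num.min (Num.min e q) (rho / 2)).
    by rewrite !lt_min e0 q0 rho2.
  move=> t; set dl := Num.min _ (rho / 2) => /andP[tu tv].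
  have [d1 d2 d3] : [/\ dl <= e, dl <= q & dl <= rho / 2].
    by rewrite /dl !ge_min !lexx !orbT.
  have [tt|tt] := ltP (time_val t) (time_val t0).
    have : mdist l (phi t) < rho / 2.
      by apply: leftP; rewrite /u in tu; apply/andP; split; lra.
    by rewrite ge_min => h; apply/orP; left; lra.
  have : mdist (phi t0) (phi t) < rho / 2.
    by apply: rightP; apply/andP; split; lra.
  by rewrite ge_min => h; apply/orP; right; lra.
have [t0T'|t0T'] := ltP (time_val t0) T.
  pose v := time_val t0 + Num.min q (T - time_val t0).
  have vq : v <= time_val t0 + q by rewrite lerD2l ge_min lexx.
  have vT' : v <= T by rewrite /v -lerBrDl ge_min lexx orbT.
  have v0 : time_val t0 < v by rewrite ltrDl lt_min q0 subr_gt0.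
  have uv : u < v by rewrite /u; lra.
  have vT : 0 <= v <= T by apply/andP; split; lra.
  have G_open := open_tube (T := T) (mdist_Lip (phi t0)) (a := v) (b := v) (rho := rho).
  apply: (nj rho u v C uT vT _ rhoI uv G_open _ _ _ _ phi_u IC).
  - apply: (mem_tube_near (e := v - time_val t0)) => //; first by rewrite subr_gt0.
    move=> t /andP[h1 h2]; apply: rightP; apply/andP; split; lra.
  - by move=> n; exact: tube_event_measurable.
  - by move=> psi h; apply: (tube_le h); rewrite /time_val /= lexx.
  - by apply: (phi_uv v q) => //; lra.
have t0E : time_val t0 = T by apply/eqP; rewrite eq_le t0T.
have uv : u < T by rewrite /u; lra.
have vT : 0 <= T <= T by rewrite lexx (ltW T_gt0).
have tE : mktime vT = t0 by apply: time_val_inj; rewrite t0E.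
have G_open := open_last (mdist_Lip (phi t0)) (rho := rho) t0E.
apply: (nj rho u T C uT vT _ rhoI uv G_open _ _ _ _ phi_u IC).
- by rewrite /= mdistxx.
- by move=> n; exact: (measurable_last _ (@X_measurable n) (@graphon_pathE n)).
- by move=> psi /= /ltW; rewrite tE.
- by apply: (phi_uv T e2) => //; rewrite t0E.
Qed.

Lemma a_large (c : R) : \forall n \near \oo, c <= a n.
Proof. by move: a_cvg => /cvgryPge/(_ c). Qed.

Lemma midpoint_ge (f g h : R) : `|g - h| < (g - f) / 4 ->
  (f + g) / 2 + Num.min 1 ((g - f) / 4) <= h.
Proof.
rewrite ltr_norml => /andP[_ h2].
have : Num.min 1 ((g - f) / 4) <= (g - f) / 4 by rewrite ge_min lexx orbT.
by lra.
Qed.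

Lemma midpoint_le (f g h : R) : `|f - h| < (g - f) / 4 ->
  - ((f + g) / 2) + Num.min 1 ((g - f) / 4) <= - h.
Proof.
rewrite ltr_norml => /andP[h1 _].
have : Num.min 1 ((g - f) / 4) <= (g - f) / 4 by rewrite ge_min lexx orbT.
by lra.
Qed.

Lemma inv_mixing (c gap eta A : R) : 0 < c -> 0 < gap -> 0 < eta ->
  (c * gap * eta)^-1 <= A -> (2 * (A * c) * gap)^-1 <= eta / 2.
Proof.
move=> c0 gap0 eta0 h; have q0 : 0 < c * gap * eta.
  by apply: mulr_gt0 => //; exact: mulr_gt0.
have A0 : 0 < A by apply: lt_le_trans h; rewrite invr_gt0.
have -> : eta / 2 = (2 / eta)^-1 by rewrite invf_div.
have q1 : 0 < 2 * (A * c) * gap.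
  by apply: mulr_gt0 => //; apply: mulr_gt0 => //; exact: mulr_gt0.
have q2 : 0 < 2 / eta by rewrite divr_gt0.
rewrite lef_pV2 ?posrE// ler_pdivrMr//.
have : (c * gap * eta)^-1 * (c * gap * eta) <= A * (c * gap * eta).
  by rewrite ler_wpM2r// ltW.
by rewrite mulVf ?gt_eqF//; lra.
Qed.

Lemma mem_tube_continuous (phi : cadlag_path T (S0_metric m)) (t0 : time T) (e rho : R) :
  0 < e -> 0 < rho ->
  (forall t, `|time_val t - time_val t0| < e -> mdist (phi t0) (phi t) < rho / 2) ->
  tube (mdist (phi t0)) (time_val t0 - e / 2) (time_val t0 + e / 2) rho phi.
Proof.
move=> e0 rho0 near_phi; apply: (mem_tube_near (e := e / 2)) => //; first exact: divr_gt0.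
by move=> t /andP[h1 h2]; apply: near_phi; rewrite ltr_norml; apply/andP; split; lra.
Qed.

(* At each of the [2 k] times of a grid the mean of [L] starting from the empty
   graph is on one side of [al]; one of the two paths then requires a deviation
   at [k] times at least, at cost [exp (- n ^ 2 eta ^ 2 k / 32)]. *)
Lemma slow_speed (phi1 phi2 : cadlag_path T (S0_metric m)) (t0 : time T) (C M : R) :
  path_continuous phi1 -> path_continuous phi2 ->
  (I phi1 <= C%:E)%E -> (I phi2 <= C%:E)%E -> phi1 t0 <> phi2 t0 ->
  \forall n \near \oo, M * (n * n)%:R < b n.
Proof.
move=> c1 c2 I1 I2 ne12.
have [L [w [wn LE Lc L12]]] := S0_separation m ne12.
pose al := (L (phi1 t0) + L (phi2 t0)) / 2.
pose gp := (L (phi2 t0) - L (phi1 t0)) / 4.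
have gp0 : 0 < gp by rewrite divr_gt0// subr_gt0.
pose eta := Num.min 1 gp.
have eta0 : 0 < eta by rewrite lt_min ltr01.
have eta1 : eta <= 1 by rewrite ge_min lexx.
have [r1 r10 Lc1] := Lc (phi1 t0) gp gp0; have [r2 r20 Lc2] := Lc (phi2 t0) gp gp0.
pose rho := Num.min r1 r2 / 2.
have rmin0 : 0 < Num.min r1 r2 by rewrite lt_min r10.
have rho0 : 0 < rho by rewrite divr_gt0.
have rhomin : rho < Num.min r1 r2 by rewrite /rho ltr_pdivrMr// ltr_pMr// ltr1n.
have [rho1 rho2] : rho < r1 /\ rho < r2 by move: rhomin; rewrite lt_min => /andP.
have rh0 : 0 < rho / 2 by rewrite divr_gt0.
have [k1 k10 near1] := c1 t0 _ rh0; have [k2 k20 near2] := c2 t0 _ rh0.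
pose kap := Num.min k1 k2.
have kap0 : 0 < kap by rewrite lt_min k10.
pose lo := time_val t0 - kap / 2; pose hi := time_val t0 + kap / 2.
pose G1 : set (cadlag_path T (S0_metric m)) := tube (mdist (phi1 t0)) lo hi rho.
pose G2 : set (cadlag_path T (S0_metric m)) := tube (mdist (phi2 t0)) lo hi rho.
have G1phi : G1 phi1.
  by apply: mem_tube_continuous => // t tt; apply: near1;
    rewrite (lt_le_trans tt)// ge_min lexx.
have G2phi : G2 phi2.
  by apply: mem_tube_continuous => // t tt; apply: near2;
    rewrite (lt_le_trans tt)// ge_min lexx orbT.
have low1 := ldp_lower b_gt0 ldp
  (open_tube (mdist_Lip (phi1 t0)) (a := lo) (b := hi) (rho := rho)) G1phi I1
  (tube_event_measurable (mdist (phi1 t0)) lo hi rho).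
have low2 := ldp_lower b_gt0 ldp
  (open_tube (mdist_Lip (phi2 t0)) (a := lo) (b := hi) (rho := rho)) G2phi I2
  (tube_event_measurable (mdist (phi2 t0)) lo hi rho).
pose A := eta ^+ 2 / 32.
have A0 : 0 < A by rewrite divr_gt0// exprn_gt0.
pose D := `|C + 1| * `|M|.
have D0 : 0 <= D by rewrite mulr_ge0.
(* [b n <= M * n ^ 2] would make the lower bound at least [expR (- (D * n ^ 2))], whereas [k]
   deviations allow at most [expR (- (k * A * n ^ 2))]. *)
pose k := (Num.bound (D / A)).+1.
have kA : D < k%:R * A.
  rewrite -ltr_pdivrMr//; apply: lt_trans (archi_boundP (divr_ge0 D0 (ltW A0))) _.
  by rewrite ltr_nat.
have [u [v [u0 uv vT ulo vhi]]] := time_window t0 T_gt0 (divr_gt0 kap0 (ltr0n R 2)).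
pose N2 := (k + k)%N; have N20 : (0 < N2)%N by [].
have [tau [gap [gap0 [tau_mono tau_gap tauuv]]]] := time_grid u0 uv vT N20.
have tauin l : lo <= time_val (tau l) <= hi.
  by have /andP[h1 h2] := tauuv l; rewrite (le_trans ulo h1) (le_trans h2 vhi).
near=> n.
have reg : forall s (i j : 'I_n), bounded_left_continuous T (betan s i j) by near: n.
have n0 : (0 < n)%N by near: n; exact: nbhs_infty_gt.
have l1 : expR (- ((C + 1) * b n)) <= Pr P [set w | G1 (Y n w)] by near: n.
have l2 : expR (- ((C + 1) * b n)) <= Pr P [set w | G2 (Y n w)] by near: n.
have an : (c_beta * gap * eta)^-1 <= a n by near: n; exact: a_large.
have a0 := a_gt0 n0.
have [C0 C0P] := rates_bounded reg.
have [p [p_tf p_markov]] := transition_data n.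
have nn0 : (0 : R) < (n * n)%:R by rewrite ltr0n muln_gt0 n0.
have mixing := inv_mixing c_beta_gt0 gap0 eta0 an.
have cardK : #|{: 'I_n * 'I_n}|%:R = (n * n)%:R :> R by rewrite card_prod card_ord.
have dev al' w' (E : set Omega) : (forall q, `|w' q| <= (n * n)%:R^-1) -> measurable E ->
    (forall v l, E v -> al' + eta <= \sum_q (conf (@Xk n) (tau l) v q)%:R * w' q) ->
    Pr P E <= expR (- ((n * n)%:R * A)) ^+
      (\sum_(l < N2) (reference_mean p w' tau l <= al')%R)%N.
  move=> wle mE EP.
  apply: (@deviation _ _ _ P T _ (@Xk n) p (fun k s t => a n * betan s k.1 k.2 t)
    (a n * c_beta) (fun=> a n * C0) _ _ _ _ p_tf (@X_measurable n) p_markov (@X_indep n)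
    _ al' eta w' N2 tau gap nn0 cardK eta0 eta1 wle tau_mono gap0 tau_gap mixing E mE).
  - exact: mulr_gt0.
  - by move=> q s; exact: rate_measurable.
  - by move=> q s t; exact: rate_lower.
  - by move=> q s t tT; rewrite ler_pM2l// C0P.
  - by move=> v' l Ev _; exact: EP.
have GrE c : L (Gr c) = \sum_q (c q)%:R * w n q.
  by rewrite LE; apply: eq_bigr => -[].
have sep1 v' l : G1 (Y n v') -> - al + eta <=
    \sum_q (conf (@Xk n) (tau l) v' q)%:R * - w n q.
  move=> G1v; under eq_bigr do rewrite mulrN; rewrite sumrN -GrE; apply: midpoint_le.
  by rewrite -graphon_pathE; apply: Lc1; exact: le_lt_trans (tube_le G1v (tauin l)) rho1.
have sep2 v' l : G2 (Y n v') -> al + eta <= \sum_q (conf (@Xk n) (tau l) v' q)%:R * w n q.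
  move=> G2v; rewrite -GrE; apply: midpoint_ge.
  by rewrite -graphon_pathE; apply: Lc2; exact: le_lt_trans (tube_le G2v (tauin l)) rho2.
have d1 : Pr P [set w | G1 (Y n w)] <= expR (- ((n * n)%:R * A)) ^+
      (\sum_(l < N2) (al <= reference_mean p (w n) tau l)%R)%N.
  have wN q : `|- w n q| <= (n * n)%:R^-1 by rewrite normrN wn.
  have := dev (- al) _ _ wN (tube_event_measurable (mdist (phi1 t0)) lo hi rho n) sep1.
  congr (_ <= _ ^+ _); apply: eq_bigr => l _; congr nat_of_bool.
  rewrite -lerN2 opprK /reference_mean -sumrN; congr (_ <= _).
  by apply: eq_bigr => q _; rewrite mulNr opprK.
have d2 := dev al _ _ (@wn n ^~ n0)
  (tube_event_measurable (mdist (phi2 t0)) lo hi rho n) sep2.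
have cost J (E : R) : (k <= J)%N -> expR (- ((C + 1) * b n)) <= E ->
    E <= expR (- ((n * n)%:R * A)) ^+ J -> M * (n * n)%:R < b n.
  move=> kJ El Eu; have : expR (- ((C + 1) * b n)) <= expR (- ((n * n)%:R * A)) ^+ k.
    apply: le_trans El (le_trans Eu _); apply: ler_wiXn2l; rewrite ?expR_ge0//.
    by rewrite -[leRHS]expR0 ler_expR oppr_le0 mulr_ge0// ltW.
  rewrite -expRM_natl ler_expR mulrN lerN2 => h.
  rewrite ltNge; apply/negP => bM.
  have h1 : (C + 1) * b n <= `|C + 1| * (`|M| * (n * n)%:R).
    apply: (@le_trans _ _ (`|C + 1| * b n)).
      by rewrite ler_wpM2r ?ler_norm// ltW.
    by rewrite ler_wpM2l// (le_trans bM)// ler_wpM2r ?ler_norm// ltW.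
  have h2 : D * (n * n)%:R < k%:R * A * (n * n)%:R by rewrite ltr_pM2r.
  move: h2; rewrite ltNge => /negP; apply.
  by rewrite -mulrA (mulrC A) /D -[leRHS]mulrA (le_trans h h1).
(* Every time counts for at least one path, so one of the two counts reaches [k]. *)
have : (k + k <= (\sum_(l < N2) (al <= reference_mean p (w n) tau l)%R) +
    (\sum_(l < N2) (reference_mean p (w n) tau l <= al)%R))%N.
  rewrite -big_split/= -[leqLHS]card_ord -sum1_card; apply: leq_sum => l _.
  by case: (leP al (reference_mean p (w n) tau l)) => [_|/ltW ->].
move=> cnt; have [h|h] := leqP k (\sum_(l < N2) (al <= reference_mean p (w n) tau l)%R)%N.
  exact: cost h l1 d1.
apply: cost _ l2 d2; rewrite leqNgt; apply/negP => h'.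
by move: cnt; rewrite leqNgt -addSn leq_add// ltnW.
Unshelve. all: by end_near.
Qed.

Let one : S0_metric m := graphon R (fun _ _ : 'I_1 => true).
Let zero : S0_metric m := graphon R (fun _ _ : 'I_1 => false).

(* Closed: the paths that come arbitrarily close to the full graphon, and to the
   empty one, in every neighbourhood of [[s, t]]. *)
Definition full_and_empty (s t : R) : set (cadlag_path T (S0_metric m)) :=
  ~` (tube (fun h => - mdist one h) s t 0 `|` tube (fun h => - mdist zero h) s t 0).

Lemma closed_full_and_empty s t : closed (full_and_empty s t).
Proof.
by apply: open_closedC; apply: openU; apply: open_tube; exact: mdistN_Lip.
Qed.

Lemma measurable_full_and_empty s t n : measurable [set w | full_and_empty s t (Y n w)].
Proof.
have := measurableC (measurableU _ _
  (tube_event_measurable (fun h => - mdist one h) s t 0 n)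
  (tube_event_measurable (fun h => - mdist zero h) s t 0 n)).
by [].
Qed.

Lemma full_and_emptyP s t psi dl : full_and_empty s t psi -> 0 < dl ->
  (exists r, s - dl < time_val r < t + dl /\ mdist one (psi r) < dl) /\
  (exists r, s - dl < time_val r < t + dl /\ mdist zero (psi r) < dl).
Proof.
move=> /not_orP[n1 n0] dl0; split; apply: contrapT => none.
  apply: n1; exists dl => // r rI; rewrite sub0r lerN2 leNgt; apply/negP => h.
  by apply: none; exists r.
apply: n0; exists dl => // r rI; rewrite sub0r lerN2 leNgt; apply/negP => h.
by apply: none; exists r.
Qed.

(** One [B] dominates both signs, since [full_then_empty] has a single upper bound per edge. *)
Definition total_rate_le (C : R) (n : nat) := exists B : 'I_n -> 'I_n -> R,
  (forall s i j r, 0 <= r <= T -> betan s i j r <= B i j) /\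
  \sum_(k : 'I_n * 'I_n) B k.1 k.2 <= C * (n * n)%:R.

(** For large [a n] both [[0, s]] and [[s, t]] are long enough for [full_then_empty]. Cancelling
    [a n], the exponent becomes [4] times the sum of [1 + B / c_beta] over the edges; the maximum
    with [1] only ensures positivity. *)
Lemma full_and_empty_lower (C s t : R) : (\forall n \near \oo, total_rate_le C n) ->
  0 < s -> s < t -> t <= T ->
  exists C' : R, 0 < C' /\ \forall n \near \oo,
    expR (- (C' * (n * n)%:R)) <= Pr P [set w | full_and_empty s t (Y n w)].
Proof.
move=> BP s0 st tT; exists (Num.max 1 (4 * (1 + C / c_beta))).
split; first by rewrite lt_max ltr01.
have sI : 0 <= s <= T by rewrite (ltW s0) (le_trans (ltW st) tT).
have tI : 0 <= t <= T by rewrite tT andbT; lra.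
near=> n.
have n0 : (0 < n)%N by near: n; exact: nbhs_infty_gt.
have [B [Bn Bsum]] : total_rate_le C n by near: n.
have as_ : 2 / (c_beta * s) <= a n by near: n; exact: a_large.
have at_ : 2 / (c_beta * (t - s)) <= a n by near: n; exact: a_large.
have a0 := a_gt0 n0.
have [p [p_tf p_markov]] := transition_data n.
have long r : 0 < r -> 2 / (c_beta * r) <= a n -> 1 <= a n * c_beta / 2 * r.
  move=> r0; rewrite ler_pdivrMr ?mulr_gt0// => h.
  have -> : a n * c_beta / 2 * r = a n * (c_beta * r) / 2 by ring.
  by rewrite ler_pdivlMr// mul1r.
apply: (@le_trans _ _ (expR (- (4 * (\sum_(k : 'I_n * 'I_n)
    (a n * c_beta + a n * B k.1 k.2) / (a n * c_beta)))))).
  rewrite ler_expR lerN2.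
  rewrite (eq_bigr (fun k => 1 + c_beta^-1 * B k.1 k.2)); last first.
    by move=> k _; field; rewrite !gt_eqF.
  rewrite big_split/= sumr_const card_prod card_ord -mulr_sumr.
  apply: (@le_trans _ _ (4 * (1 + C / c_beta) * (n * n)%:R)); last first.
    by rewrite ler_wpM2r// le_max lexx orbT.
  rewrite -mulrA ler_pM2l// mulrDl mul1r lerD2l (mulrC C) -mulrA.
  by rewrite ler_wpM2l// invr_ge0 ltW.
apply: (@full_then_empty _ _ _ P T _ (@Xk n) p (fun k s t => a n * betan s k.1 k.2 t)
    (fun k => x k.1 k.2) (a n * c_beta) (fun k => a n * B k.1 k.2) (ltW T_gt0)
    _ _ _ _ p_tf (@X_measurable n) _ p_markov (@X_indep n) (mktime sI) (mktime tI)
    _ _ _ (measurable_full_and_empty s t n)).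
- exact: mulr_gt0.
- by move=> q r; exact: rate_measurable.
- by move=> q r r'; exact: rate_lower.
- by move=> q r r' rT; rewrite ler_pM2l// Bn.
- by move=> q w r r0; case: (X_markov q.1 q.2) => _ h _; exact: h.
- by apply: long.
- by apply: long => //=; rewrite subr_gt0.
- have Gcst (c : bool) : Gr [ffun _ : 'I_n * 'I_n => c] =
      graphon R (fun _ _ : 'I_1 => c).
    rewrite -(graphon_cst R c n0) /Gr; congr graphon.
    by apply/funext => i; apply/funext => j; rewrite ffunE.
  move=> w cs ct; apply/not_orP; split=> -[dl dl0 h].
    have : - mdist one (Y n w (mktime sI)) <= 0 - dl.
      by apply: h; rewrite /time_val /=; apply/andP; split; lra.
    by rewrite graphon_pathE cs Gcst mdistxx oppr0 sub0r oppr_ge0 leNgt dl0.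
  have : - mdist zero (Y n w (mktime tI)) <= 0 - dl.
    by apply: h; rewrite /time_val /=; apply/andP; split; lra.
  by rewrite graphon_pathE ct Gcst mdistxx oppr0 sub0r oppr_ge0 leNgt dl0.
Unshelve. all: by end_near.
Qed.

Lemma fast_speed (C : R) : (\forall n \near \oo, total_rate_le C n) ->
  (forall M, \forall n \near \oo, M * (n * n)%:R < b n) -> False.
Proof.
move=> BP fast; pose s := T / 2.
pose th k : R := s / k.+1%:R.
have s0 : 0 < s by rewrite divr_gt0.
have thI k : 0 < th k <= s.
  by rewrite divr_gt0//= ler_pdivrMr// ler_peMr// ?ler1n// ltW.
(* A cost of order [n ^ 2] is negligible against [b n]. The level [1] is arbitrary; it places all
   these paths in one compact set. *)
have /choice[phi phiP] : forall k, exists phi : cadlag_path T (S0_metric m),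
    full_and_empty s (s + th k) phi /\ (I phi <= 1%:E)%E.
  move=> k; have /andP[th0 ths] := thI k.
  have st : s < s + th k by lra.
  have tT : s + th k <= T by rewrite [leRHS]splitr lerD2l.
  have [C' [C'0 low]] := full_and_empty_lower BP s0 st tT.
  have [|phi Fphi Iphi] := ldp_upper b_gt0 ldp (@closed_full_and_empty s (s + th k))
    ltr01 (measurable_full_and_empty s (s + th k)).
    move=> e e0; have := fast (C' / e); apply: filterS2 low => n nlow nfast.
    apply: le_trans nlow; rewrite ler_expR lerN2.
    by move: nfast => /ltW; rewrite mulrAC ler_pdivrMr// mulrC (mulrC e).
  by exists phi; split => //; exact: ltW.
have [I0 /(_ 1) cpt] := I_rate.
have FI : \forall k \near \oo, (I (phi k) <= 1%:E)%E.
  by apply: nearW => k; have [] := phiP k.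
have [psi [Ipsi clpsi]] := cpt (phi k @[k --> \oo]) _ FI.
have cpsi := finite_rate_continuous Ipsi.
have D0 : 0 < mdist one zero.
  rewrite mdist_gt0; apply/eqP; exact: graphon_full_empty.
have sT : 0 <= s <= T by rewrite /s; apply/andP; move: T_gt0; split; lra.
pose ts := mktime sT.
(* Two distances of at most [2 * rho] to [psi ts] and two below [q <= rho] to the constant graphons
   would join [one] to [zero] within [6 * rho]. *)
pose rho := mdist one zero / 8.
have rho0 : 0 < rho by rewrite divr_gt0.
have [e e0 near_psi] := cpsi ts _ rho0.
pose kap := e / 4; have kap0 : 0 < kap by rewrite divr_gt0.
pose G : set (cadlag_path T (S0_metric m)) :=
  tube (mdist (psi ts)) (s - kap) (s + kap) (2 * rho).
have Gpsi : G psi.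
  apply: (mem_tube_near kap0); first by rewrite mulr_gt0.
  move=> t /andP[h1 h2]; rewrite (_ : 2 * rho / 2 = rho); last by field.
  apply: near_psi; rewrite ltr_norml (_ : time_val ts = s)//.
  by rewrite /kap in h1 h2; apply/andP; split; lra.
have nG : nbhs psi G.
  by apply: open_nbhs_nbhs; split => //; apply: open_tube; exact: mdist_Lip.
have small : \forall k \near \oo, th k < kap / 2.
  near=> k; rewrite /th ltr_pdivrMr// -ltr_pdivrMl ?divr_gt0//.
  apply: (@lt_trans _ _ k%:R); last by rewrite ltr_nat.
  by near: k; exact: nbhs_infty_gtr.
(* Clustering yields a path and not an index; recording the index in the set of paths ensures that
   the window of the path found is short. *)
have Fsmall : \forall k \near \oo, exists k', th k' < kap / 2 /\ phi k' = phi k.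
  by apply: filterS small => k kk; exists k.
have [_ [[k [kk <-]] hG]] :=
  clpsi [set psi' | exists k', th k' < kap / 2 /\ phi k' = psi'] G Fsmall nG.
pose q := Num.min (kap / 2) rho.
have q0 : 0 < q by rewrite lt_min rho0 divr_gt0.
have [q1 q2] : q <= kap / 2 /\ q <= rho by rewrite /q !ge_min !lexx orbT.
have [[r1 [/andP[r11 r12] d1]] [r2 [/andP[r21 r22] d2]]] :=
  full_and_emptyP (phiP k).1 q0.
have h1 : mdist (psi ts) (phi k r1) <= 2 * rho.
  by apply: (tube_le hG); apply/andP; split; lra.
have h2 : mdist (psi ts) (phi k r2) <= 2 * rho.
  by apply: (tube_le hG); apply/andP; split; lra.
have t1 := metric_triangle one (phi k r1) zero.
have t2 := metric_triangle (phi k r1) (psi ts) zero.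
have t3 := metric_triangle (psi ts) (phi k r2) zero.
rewrite (metric_sym (phi k r1) (psi ts)) in t2.
rewrite (metric_sym (phi k r2) zero) in t3.
have rE : 8 * rho = mdist one zero by rewrite /rho mulrC divfK.
by lra.
Unshelve. all: by end_near.
Qed.

Lemma ldp_trivial (C : R) : (\forall n \near \oo, total_rate_le C n) ->
  trivial_rate_function I.
Proof.
move=> BC phi; apply: contrapT => /not_orP[I0 Ioo].
have [r r0 IE] : exists2 r : R, 0 < r & I phi = r%:E.
  have [/(_ phi) + _] := I_rate; move: I0 Ioo.
  case: (I phi) => [r r0 _|//|//]; rewrite lee_fin => r_ge0; exists r => //.
  by rewrite lt_neqAle r_ge0 andbT eq_sym; apply/eqP => rE; apply: r0; rewrite rE.
have mT n : measurable [set w | [set: cadlag_path T (S0_metric m)] (Y n w)].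
  by rewrite (_ : [set w | _] = setT).
(* The whole space has probability [1], so some path has a cost below [r = I phi]: it differs from
   [phi], and both costs are finite. *)
have [|phi' _ I'] := ldp_upper b_gt0 ldp closedT r0 mT.
  move=> e e0; apply: nearW => n; rewrite (_ : [set w | _] = setT)// PrT.
  by rewrite -[leRHS]expR0 ler_expR oppr_le0 mulr_ge0// ltW.
have [t0 ne] : exists t0, phi t0 <> phi' t0.
  apply: contrapT => same; move: I'; rewrite -IE (_ : phi = phi') ?ltxx//.
  have : path_fun phi = path_fun phi'.
    by apply/funext => t; apply: contrapT => ne; apply: same; exists t.
  case: (phi) (phi') => [f fc] [f' fc'] /= ff'; move: fc fc'; rewrite ff' => fc fc'.
  by congr CadlagPath; exact: Prop_irrelevance.
have Ir : (I phi <= r%:E)%E by rewrite IE.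
apply: (fast_speed BC) => M.
exact: (slow_speed M (finite_rate_continuous Ir)
  (finite_rate_continuous (ltW I')) Ir (ltW I') ne).
Qed.

End model.

(* The boolean [s] is the sign: [beta true] is beta^+ (rates of the jumps to 1)
   and [beta false] is beta^- (rates of the jumps to 0).  The index [n] ranges
   over the positive integers: nothing depends on the entries at [n = 0]. *)
Theorem proposition3p5 (R : realType) (T : R) (T_gt0 : 0 < T)
  (beta : bool -> plane R -> R -> R)
  (betan : bool -> forall n : nat, 'I_n -> 'I_n -> R -> R)
  (beta_ge0 : forall s z (t : R), unit_square z -> 0 <= t <= T -> 0 <= beta s z t)
  (beta_meas : forall s,
    measurable_fun (cylinder T) (fun q => beta s q.1 q.2))
  (betan_ge0 : forall s n (i j : 'I_n) (t : R), 0 <= t <= T -> 0 <= betan s n i j t)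
  (betan_meas : forall s n (i j : 'I_n),
    measurable_fun `[0, T]%classic (betan s n i j))
  (beta_L1 : forall s,
    (leb3 R).-integrable (cylinder T) (fun q => (beta s q.1 q.2)%:E))
  (betan_L1 : forall s n,
    (leb3 R).-integrable (cylinder T)
      (fun q => (step (fun i j : 'I_n => betan s n i j q.2) q.1)%:E))
  (betan_cvg : forall s,
    (\int[leb3 R]_(q in cylinder T)
       `|step (fun i j : 'I_n => betan s n i j q.2) q.1 - beta s q.1 q.2|%:E)%E
      @[n --> \oo] --> 0%E)
  (c_beta : R) (c_beta_gt0 : 0 < c_beta)
  (betan_ge : forall s n (i j : 'I_n) (t : R),
    0 <= t <= T -> c_beta <= betan s n i j t)
  (beta_reg : forall s,
    {ae leb2 R, forall z, unit_square z -> bounded_left_continuous T (beta s z)})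
  (betan_reg : \forall n \near \oo, forall s (i j : 'I_n),
    bounded_left_continuous T (betan s n i j))
  (a : nat -> R) (a_gt0 : forall n, (0 < n)%N -> 0 < a n)
  (a_cvg : a n @[n --> \oo] --> +oo)
  (d : measure_display) (Omega : measurableType d) (P : probability Omega R)
  (x : forall n : nat, 'I_n -> 'I_n -> bool)
  (X : forall n : nat, 'I_n -> 'I_n -> Omega -> cadlag_path T bool)
  (X_markov : forall n (i j : 'I_n),
    markov_chain P (fun s t => a n * betan s n i j t) (x n i j) (X n i j))
  (X_indep : forall n,
    mutually_independent P (fun k : 'I_n * 'I_n => X n k.1 k.2))
  (m : weak_metric R)
  (sup_beta_L1 : forall s,
    in_L1 (@unit_square R) (fun z => sup_time T (beta s z)))
  (sup_betan_cvg : forall s,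
    (\int[leb2 R]_(z in @unit_square R)
       sup_time T (fun t =>
         `|step (fun i j : 'I_n => betan s n i j t) z - beta s z t|%R))%E
      @[n --> \oo] --> 0%E) :
  ~ exists b : nat -> R, (forall n, 0 < b n) /\
    exists I : cadlag_path T (S0_metric m) -> \bar R,
      [/\ rate_function I,
          satisfies_LDP P
            (fun n w => graphon_path m (fun i j : 'I_n => X n i j w)) b I &
          ~ trivial_rate_function I].
Proof.
move=> [b [b_gt0 [I [I_rate ldp]]]]; apply.
have bounded s : \forall n \near \oo, forall i j : 'I_n,
    exists M : R, forall t, 0 <= t <= T -> betan s n i j t <= M.
  apply: filterS betan_reg => n reg i j; have [[M MP] _] := reg s i j.
  by exists M => t tT; apply: le_trans (MP t tT); exact: ler_norm.
have sum_rates s := sum_sup_rates T_gt0 (beta_ge0 s) (betan_ge0 s) (bounded s)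
  (sup_beta_L1 s) (sup_betan_cvg s).
have [C1 B1] := sum_rates true; have [C0 B0] := sum_rates false.
apply: (ldp_trivial T_gt0 betan_meas c_beta_gt0 betan_ge betan_reg a_gt0
  a_cvg X_markov X_indep b_gt0 I_rate ldp (C := C1 + C0)).
apply: filterS2 B1 B0 => n [B1 [le1 sum1]] [B0 [le0 sum0]].
exists (fun i j => B1 i j + B0 i j); split.
  move=> s i j r rT.
  have p1 : 0 <= B1 i j := le_trans (betan_ge0 true n i j r rT) (le1 i j r rT).
  have p0 : 0 <= B0 i j := le_trans (betan_ge0 false n i j r rT) (le0 i j r rT).
  case: s; first by apply: le_trans (le1 i j r rT) _; rewrite lerDl.
  by apply: le_trans (le0 i j r rT) _; rewrite lerDr.
by rewrite big_split/= mulrDl lerD.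
Qed.
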